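(* Let $(F,v)$ be a henselian (non-trivially) valued field of positive characteristic $p>0$. Let $R:=F[t;x\mapsto x^p]$, identified with the ring of additive polynomials over $F$. Then the following assertions are equivalent: 1. $(F,v)$ is affinely maximal as a valued $R$-module. 2. $(F,v)$ is algebraically maximal (as a valued field). 3. For every one-variable (usual) polynomial $G$ over $F$, the set $\{v(G(a)) : a\in F\}$ has a maximum in $vF$. 4. For every additive polynomial $Q$ over $F$ and every $b\in F$, the set $\{v(Q(a)-b): a\in F\}$ has a maximum in $vF$.
   Context: $R=F[t;x\mapsto x^p]$ is the skew polynomial ring with $at=ta^p$ for $a\in F$; every $r\in R$ is uniquely a finite sum $\sum_i t^ia_i$, and acts on $F$ as the additive polynomial $x.r=\sum_i a_ix^{p^i}$. The non-zero terms $t^ia_i$ are the monomials of $r$; $t^ia_i$ has degree $i$. $vF$ denotes $\{v(a):a\in F\}$, including $\infty=v(0)$. It is an ordered set with an action of $R$ given by $\gamma\cdot t^ia=p^i\gamma+v(a)$ for $\gamma \neq\infty$, $a\ne0$, $\gamma\cdot r=\min_i\gamma\cdot\mathbf m_i$ over the monomials $\mathbf m_i$ of $r\neq0$, $\gamma\cdot0=\infty$, $\infty\cdot r=\infty$. With this, $(F,v)$ is a valued $R$-module in the following sense. **$R$-chains** (with $K=F$, $\varphi:x\mapsto x^p$). An $R$-chain is a linear order $(\Delta,<)$ with top element $\infty$ and unary functions $\gamma\mapsto\gamma\cdot r$ $(r\in R)$ such that for all non-zero $a,b\in K$ and $\gamma,\delta\in\Delta\setminus\{\infty\}$: $\gamma>\delta\Rightarrow\gamma\cdot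 a>\delta\cdot a$; $\gamma\cdot ab=(\gamma\cdot a)\cdot b$; $\gamma\cdot a>\gamma\Rightarrow\delta\cdot a>\delta$; $\gamma\cdot(a\pm b)\ge\min\{\gamma\cdot a,\gamma\cdot b\}$; $\gamma\cdot0=\infty$, $\gamma\cdot1=\gamma$, $\infty\cdot b=\infty$; and moreover: (1) $\cdot t$ is strictly increasing on $\Delta\setminus\{\infty\}$ and $\infty\cdot t=\infty$; (2) $\gamma\cdot ta=(\gamma\cdot t)\cdot a$ and $\gamma\cdot t^na=(\gamma\cdot t^{n-1})\cdot ta$; (3) $\gamma\cdot r=\min_i\{\gamma\cdot\mathbf m_i\}$ for all non-zero $r$ with monomials $\mathbf m_i$; (4) for monomials with $0\le\deg\mathbf m_2<\deg\mathbf m_1$ and $\gamma\ne\infty$: if $\gamma\cdot\mathbf m_1\le\gamma\cdot\mathbf m_2$ then $\delta\cdot\mathbf m_1<\delta\cdot\mathbf m_2$ for all $\delta<\gamma$. **Valued modules.** A valued $R$-module $(M,v)$ is a right $R$-module $M$ with a surjective map $v:M\to\Delta$ onto an $R$-chain such that $v(x\pm y)\ge\min\{v(x),v(y)\}$, $v(x)=\infty\iff x=0$, $v(x.a)=v(x)\cdot a$ for $a\in K$, and $v(x.t)=v(x)\cdot t$. An extension $M\subseteq N$ of valued modules is immediate if for every non-zero $x\in N$ there is $y\in M$ with $v(x-y)>v(y)$; it is affine if for every $x\in N$ there is a non-zero $r\in R$ with $x.r\in M$. $(M,v)$ is affinely maximal if it has no proper affine immediate extension (as valued $R$-modules). A valued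 field is algebraically maximal if it has no proper immediate algebraic valued field extension. *)

(* Defs.v *)
From HB Require Import structures.
From mathcomp Require Import all_boot all_order all_algebra.

Set Implicit Arguments.
Unset Strict Implicit.
Unset Printing Implicit Defensive.

Import Order.TTheory GRing.Theory Num.Theory.
Local Open Scope ring_scope.

(* The skew polynomial ring K[t; phi], with relation a t = t phi(a).          *)
(* The element \sum_i t^i a_i (coefficients on the right) is encoded by the   *)
(* sequence of its coefficients a_i, i.e., by an element of {poly K}, but     *)
(* the product is (t^i a) (t^j b) = t^(i + j) phi^j(a) b.                     *)

Definition skewpoly (K : fieldType) (phi : {rmorphism K -> K}) : Type :=
  {poly K}.

Section SkewPoly.
Variables (K : fieldType) (phi : {rmorphism K -> K}).
Local Notation R := (skewpoly phi).

HB.instance Definition _ := GRing.Zmodule.on R.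

Definition skcoef (r : R) (i : nat) : K := (r : {poly K})`_i.
Definition sksize (r : R) : nat := size (r : {poly K}).

Definition skew_mul (r s : R) : R :=
  \sum_(i < sksize r) \sum_(j < sksize s)
     (iter j phi (skcoef r i) * skcoef s j) *: 'X^(i + j) : {poly K}.

Lemma iter_phiD j : {morph iter j phi : x y / x + y}.
Proof. by elim: j => //= j IHj x y; rewrite !iterS IHj rmorphD. Qed.

Lemma iter_phiM j : {morph iter j phi : x y / x * y}.
Proof. by elim: j => //= j IHj x y; rewrite !iterS IHj rmorphM. Qed.

Lemma iter_phi0 j : iter j phi 0 = 0.
Proof. by elim: j => //= j ->; rewrite rmorph0. Qed.

Lemma iter_phi1 j : iter j phi 1 = 1.
Proof. by elim: j => //= j ->; rewrite rmorph1. Qed.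

Lemma skew_mul_widen (r s : R) n m : (sksize r <= n)%N -> (sksize s <= m)%N ->
  skew_mul r s = \sum_(i < n) \sum_(j < m)
     (iter j phi (skcoef r i) * skcoef s j) *: 'X^(i + j) :> {poly K}.
Proof.
move=> ler les; rewrite /skew_mul.
rewrite (big_ord_widen n (fun i => \sum_(j < sksize s)
  (iter j phi (skcoef r i) * skcoef s j) *: 'X^(i + j)) ler).
rewrite big_mkcond /=; apply: eq_bigr => i _; case: ltnP => [_ | ger].
  rewrite (big_ord_widen m (fun j =>
    (iter j phi (skcoef r i) * skcoef s j) *: 'X^(i + j)) les).
  rewrite big_mkcond /=; apply: eq_bigr => j _; case: ltnP => // ges.
  by rewrite {2}/skcoef (nth_default 0 ges) mulr0 scale0r.
rewrite big1 // => j _.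
by rewrite /skcoef (nth_default 0 ger) iter_phi0 mul0r scale0r.
Qed.

Fact skew_mulDl : left_distributive skew_mul +%R.
Proof.
move=> r1 r2 s; set n := maxn (sksize r1) (maxn (sksize r2) (sksize (r1 + r2)%R)).
have [n1 n2 n3] :
  [/\ (sksize r1 <= n), (sksize r2 <= n) & (sksize (r1 + r2)%R <= n)]%N.
  by rewrite /n !leq_max !leqnn !orbT.
rewrite (skew_mul_widen n1 (leqnn _)) (skew_mul_widen n2 (leqnn _)).
rewrite (skew_mul_widen n3 (leqnn _)) -big_split /=; apply: eq_bigr => i _.
rewrite -big_split /=; apply: eq_bigr => j _.
by rewrite {1}/skcoef coefD iter_phiD mulrDl scalerDl.
Qed.

Fact skew_mulDr : right_distributive skew_mul +%R.
Proof.
move=> r s1 s2; set n := maxn (sksize s1) (maxn (sksize s2) (sksize (s1 + s2)%R)).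
have [n1 n2 n3] :
  [/\ (sksize s1 <= n), (sksize s2 <= n) & (sksize (s1 + s2)%R <= n)]%N.
  by rewrite /n !leq_max !leqnn !orbT.
rewrite (skew_mul_widen (leqnn _) n1) (skew_mul_widen (leqnn _) n2).
rewrite (skew_mul_widen (leqnn _) n3) -big_split /=; apply: eq_bigr => i _.
rewrite -big_split /=; apply: eq_bigr => j _.
by rewrite {2}/skcoef coefD mulrDr scalerDl.
Qed.

Lemma skew_mul0r s : skew_mul 0 s = 0.
Proof. by apply: (addrI (skew_mul 0 s)); rewrite -skew_mulDl !addr0. Qed.

Lemma skew_mulr0 s : skew_mul s 0 = 0.
Proof. by apply: (addrI (skew_mul s 0)); rewrite -skew_mulDr !addr0. Qed.

Definition skmono (n : nat) (a : K) : R := a *: 'X^n : {poly K}.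

Lemma skcoef_mono n a i : skcoef (skmono n a) i = if i == n then a else 0.
Proof.
by rewrite /skcoef /skmono coefZ coefXn; case: eqP; rewrite ?mulr1 ?mulr0.
Qed.

Lemma sksize_mono n a : (sksize (skmono n a) <= n.+1)%N.
Proof. by rewrite /sksize /skmono (leq_trans (size_scale_leq _ _)) ?size_polyXn. Qed.

Lemma skmono_sum (r : R) : r = \sum_(i < sksize r) skmono i (skcoef r i).
Proof. by rewrite -[LHS](coefK (r : {poly K})) poly_def. Qed.

Lemma skew_mul_mono i j a b :
  skew_mul (skmono i a) (skmono j b) = skmono (i + j) (iter j phi a * b).
Proof.
rewrite (skew_mul_widen (sksize_mono i a) (sksize_mono j b)).
rewrite big_ord_recr big1 /= => [|k _]; last first.
  rewrite big1 // => l _; rewrite skcoef_mono ltn_eqF //.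
  by rewrite iter_phi0 mul0r scale0r.
rewrite add0r big_ord_recr big1 /= => [|k _]; last first.
  by rewrite [skcoef (skmono j b) k]skcoef_mono ltn_eqF // mulr0 scale0r.
by rewrite add0r !skcoef_mono !eqxx.
Qed.

Lemma skew_ind (P : R -> Prop) : P 0 ->
  (forall r s, P r -> P s -> P (r + s)) -> (forall n a, P (skmono n a)) ->
  forall r, P r.
Proof. by move=> P0 PD Pm r; rewrite (skmono_sum r); apply: big_ind. Qed.

Fact skew_mulA : associative skew_mul.
Proof.
elim/skew_ind=> [s u | r1 r2 IH1 IH2 s u | i a].
- by rewrite !skew_mul0r.
- by rewrite !skew_mulDl IH1 IH2.
elim/skew_ind=> [u | s1 s2 IH1 IH2 u | j b].
- by rewrite skew_mulr0 !skew_mul0r skew_mulr0.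
- by rewrite skew_mulDr !skew_mulDl skew_mulDr IH1 IH2.
elim/skew_ind=> [| u1 u2 IH1 IH2 | l c].
- by rewrite !skew_mulr0.
- by rewrite !skew_mulDr IH1 IH2.
by rewrite !skew_mul_mono addnA iter_phiM -iterD mulrA (addnC l j).
Qed.

Fact skew_mul1r : left_id (skmono 0 1) skew_mul.
Proof.
elim/skew_ind=> [| r s IHr IHs | n a]; first exact: skew_mulr0.
  by rewrite skew_mulDr IHr IHs.
by rewrite skew_mul_mono iter_phi1 mul1r.
Qed.

Fact skew_mulr1 : right_id (skmono 0 1) skew_mul.
Proof.
elim/skew_ind=> [| r s IHr IHs | n a]; first exact: skew_mul0r.
  by rewrite skew_mulDl IHr IHs.
by rewrite skew_mul_mono addn0 mulr1.
Qed.

Fact skew_oner_neq0 : skmono 0 1 != 0.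
Proof. by rewrite /skmono scale1r oner_neq0. Qed.

HB.instance Definition _ := GRing.Zmodule_isNzRing.Build R
  skew_mulA skew_mul1r skew_mulr1 skew_mulDl skew_mulDr skew_oner_neq0.

Definition skC (a : K) : R := skmono 0 a.
Definition skT : R := skmono 1 1.

Lemma skmonoM i j a b :
  skmono i a * skmono j b = skmono (i + j) (iter j phi a * b).
Proof. exact: skew_mul_mono. Qed.

Lemma skC_T (a : K) : skC a * skT = skT * skC (phi a).
Proof. by rewrite !skmonoM mul1r mulr1. Qed.

Lemma skT_exp n : skT ^+ n = skmono n 1.
Proof.
elim: n => [|n IHn]; first by rewrite expr0.
by rewrite exprS IHn skmonoM iter_phi1 mulr1.
Qed.

Lemma skmonoE n a : skmono n a = skT ^+ n * skC a.
Proof. by rewrite skT_exp skmonoM addn0 mul1r. Qed.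

Lemma skC_B a b : skC (a - b) = skC a - skC b.
Proof. by rewrite /skC /skmono scalerBl. Qed.

End SkewPoly.

(* The top element of the order plays the role of infinity.                   *)

Record is_chain (K : fieldType) (phi : {rmorphism K -> K})
    (d : Order.disp_t) (D : tOrderType d)
    (act : D -> skewpoly phi -> D) : Prop := IsChain {
  chain_lt_scal : forall (a : K) (g h : D), a != 0 ->
    g != \top%O -> h != \top%O -> (h < g)%O ->
    (act h (skC phi a) < act g (skC phi a))%O;
  chain_scalM : forall (a b : K) (g : D), a != 0 -> b != 0 -> g != \top%O ->
    act g (skC phi (a * b)) = act (act g (skC phi a)) (skC phi b);
  chain_scal_gt : forall (a : K) (g h : D), a != 0 ->
    g != \top%O -> h != \top%O ->
    (g < act g (skC phi a))%O -> (h < act h (skC phi a))%O;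
  chain_scalD : forall (a b : K) (g : D), a != 0 -> b != 0 -> g != \top%O ->
    (Order.min (act g (skC phi a)) (act g (skC phi b))
       <= act g (skC phi (a + b)))%O;
  chain_scalB : forall (a b : K) (g : D), a != 0 -> b != 0 -> g != \top%O ->
    (Order.min (act g (skC phi a)) (act g (skC phi b))
       <= act g (skC phi (a - b)))%O;
  chain_scal0 : forall g : D, act g 0 = \top%O;
  chain_scal1 : forall g : D, act g 1 = g;
  chain_top_scal : forall b : K, act \top%O (skC phi b) = \top%O;
  chain_lt_t : forall g h : D, g != \top%O -> h != \top%O -> (h < g)%O ->
    (act h (skT phi) < act g (skT phi))%O;
  chain_top_t : act \top%O (skT phi) = \top%O;
  chain_t_scal : forall (a : K) (g : D), a != 0 ->
    act g (skT phi * skC phi a) = act (act g (skT phi)) (skC phi a);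
  chain_tn_scal : forall (n : nat) (a : K) (g : D), a != 0 ->
    act g (skT phi ^+ n.+1 * skC phi a)
      = act (act g (skT phi ^+ n)) (skT phi * skC phi a);
  chain_min : forall (r : skewpoly phi) (g : D), r != 0 ->
    act g r = \big[Order.min / \top%O]_(i < sksize r | skcoef r i != 0)
                 act g (skmono phi i (skcoef r i));
  chain_lt_mono : forall (i j : nat) (a b : K) (g h : D), a != 0 -> b != 0 ->
    (j < i)%N -> g != \top%O ->
    (act g (skmono phi i a) <= act g (skmono phi j b))%O -> (h < g)%O ->
    (act h (skmono phi i a) < act h (skmono phi j b))%O
}.

Record chain (K : fieldType) (phi : {rmorphism K -> K}) := Chain {
  chain_disp : Order.disp_t;
  chain_sort :> tOrderType chain_disp;
  chain_act : chain_sort -> skewpoly phi -> chain_sort;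
  chain_axioms : is_chain chain_act
}.

(* A right R-module is a left module over the converse ring R^c.              *)

Definition ract (K : fieldType) (phi : {rmorphism K -> K})
    (M : lmodType (skewpoly phi)^c) (x : M) (r : skewpoly phi) : M :=
  (r : (skewpoly phi)^c) *: x.

Record is_valued_module (K : fieldType) (phi : {rmorphism K -> K})
    (M : lmodType (skewpoly phi)^c) (D : chain phi) (v : M -> D) : Prop :=
  IsValuedModule {
  vmod_surj : forall g : D, exists x : M, v x = g;
  vmod_valD : forall x y : M, (Order.min (v x) (v y) <= v (x + y)%R)%O;
  vmod_valB : forall x y : M, (Order.min (v x) (v y) <= v (x - y)%R)%O;
  vmod_val_top : forall x : M, v x = \top%O <-> x = 0;
  vmod_val_scal : forall (x : M) (a : K),
    v (ract x (skC phi a)) = chain_act (v x) (skC phi a);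
  vmod_val_t : forall x : M, v (ract x (skT phi)) = chain_act (v x) (skT phi)
}.

Record valued_module (K : fieldType) (phi : {rmorphism K -> K}) :=
  ValuedModule {
  vmod_sort :> lmodType (skewpoly phi)^c;
  vmod_chain : chain phi;
  vmod_val : vmod_sort -> vmod_chain;
  vmod_axioms : is_valued_module vmod_val
}.

Record vmod_extension (K : fieldType) (phi : {rmorphism K -> K})
    (M N : valued_module phi) := VmodExtension {
  vmod_emb :> {linear M -> N};
  vmod_chain_emb : vmod_chain M -> vmod_chain N;
  vmod_emb_inj : injective vmod_emb;
  vmod_chain_emb_mono : {mono vmod_chain_emb : g h / (g <= h)%O};
  vmod_chain_emb_top : vmod_chain_emb \top%O = \top%O;
  vmod_chain_emb_act : forall g r,
    vmod_chain_emb (chain_act g r) = chain_act (vmod_chain_emb g) r;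
  vmod_emb_val : forall x, vmod_val (vmod_emb x) = vmod_chain_emb (vmod_val x)
}.

Definition immediate_vmod (K : fieldType) (phi : {rmorphism K -> K})
    (M N : valued_module phi) (f : vmod_extension M N) : Prop :=
  forall x : N, x != 0 ->
    exists y : M, (vmod_val (f y) < vmod_val (x - f y)%R)%O.

Definition affine_vmod (K : fieldType) (phi : {rmorphism K -> K})
    (M N : valued_module phi) (f : vmod_extension M N) : Prop :=
  forall x : N, exists2 r : skewpoly phi, r != 0 &
    exists y : M, f y = ract x r.

Definition affinely_maximal (K : fieldType) (phi : {rmorphism K -> K})
    (M : valued_module phi) : Prop :=
  forall (N : valued_module phi) (f : vmod_extension M N),
    affine_vmod f -> immediate_vmod f -> forall y : N, exists x : M, f x = y.

HB.mixin Record isOrderedZmodule G of Num.POrderedZmodule G := {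
  ozmod_le_total : total (<=%O : rel G);
  ozmod_leD2l : forall x : G, {mono +%R x : y z / y <= z}
}.

#[short(type="orderedZmodType")]
HB.structure Definition OrderedZmodule :=
  { G of isOrderedZmodule G & Num.POrderedZmodule G }.

(* G extended with a top element infinity, absorbing for the addition.        *)

Definition extended (G : Type) : Type := option G.

HB.instance Definition _ (G : choiceType) := Choice.on (extended G).

Section ExtendedOrder.
Variable G : orderedZmodType.
Local Notation E := (extended G).

Definition ext_le (x y : E) : bool :=
  match x, y with
  | _, None => true
  | None, Some _ => false
  | Some a, Some b => a <= b
  end.

Fact ext_le_refl : reflexive ext_le.
Proof. by case=> /=. Qed.

Fact ext_le_anti : antisymmetric ext_le.
Proof. by case=> [a|] [b|] //= /le_anti ->. Qed.

Fact ext_le_trans : transitive ext_le.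
Proof. by case=> [a|] [b|] [c|] //=; apply: le_trans. Qed.

Fact ext_le_total : total ext_le.
Proof. by case=> [a|] [b|] //=; apply: ozmod_le_total. Qed.

HB.instance Definition _ := Order.Le_isPOrder.Build ring_display E
  ext_le_refl ext_le_anti ext_le_trans.
HB.instance Definition _ := Order.POrder_isTotal.Build ring_display E
  ext_le_total.

Fact ext_lex1 (x : E) : x <= (None : E).
Proof. by case: x. Qed.

HB.instance Definition _ := Order.hasTop.Build ring_display E ext_lex1.

Definition ext_add (x y : E) : E :=
  match x, y with Some a, Some b => Some (a + b) | _, _ => None end.

Fact ext_addA : associative ext_add.
Proof. by case=> [a|] [b|] [c|] //=; rewrite addrA. Qed.

Fact ext_addC : commutative ext_add.
Proof. by case=> [a|] [b|] //=; rewrite addrC. Qed.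

Fact ext_add0 : left_id (Some 0) ext_add.
Proof. by case=> [a|] //=; rewrite add0r. Qed.

HB.instance Definition _ := GRing.isNmodule.Build E ext_addA ext_addC ext_add0.

End ExtendedOrder.

(* v is onto, so that extended G is the ordered set vF (infinity included).    *)

Record valuation (F : fieldType) (G : orderedZmodType) := Valuation {
  val_fun :> F -> extended G;
  valuation_surj : forall g, exists x, val_fun x = g;
  valuation_eq_top : forall x, val_fun x = \top%O <-> x = 0;
  valuationM : forall x y, val_fun (x * y) = val_fun x + val_fun y;
  valuationD : forall x y, Order.min (val_fun x) (val_fun y) <= val_fun (x + y)
}.

Definition nontrivial (F : fieldType) (G : orderedZmodType)
    (v : valuation F G) : Prop :=
  exists x : F, x != 0 /\ v x != 0.

Definition in_valuation_ring (F : fieldType) (G : orderedZmodType)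
    (v : valuation F G) (x : F) : bool := (0 : extended G) <= v x.

Definition in_valuation_ideal (F : fieldType) (G : orderedZmodType)
    (v : valuation F G) (x : F) : bool := (0 : extended G) < v x.

(* Hensel's lemma: simple zeros in the residue field lift.                    *)

Definition henselian (F : fieldType) (G : orderedZmodType)
    (v : valuation F G) : Prop :=
  forall (f : {poly F}) (a : F), 
    (forall i, in_valuation_ring v f`_i) -> in_valuation_ring v a ->
    in_valuation_ideal v f.[a] -> ~~ in_valuation_ideal v f^`().[a] ->
    exists b : F, root f b /\ in_valuation_ideal v (b - a).

Record vfield_extension (F : fieldType) (G : orderedZmodType)
    (v : valuation F G) (L : fieldType) (H : orderedZmodType)
    (w : valuation L H) := VfieldExtension {
  vfield_emb :> {rmorphism F -> L};
  vgroup_emb : {additive G -> H};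
  vgroup_emb_mono : {mono vgroup_emb : x y / x <= y};
  vfield_emb_val : forall x,
    w (vfield_emb x) = (omap vgroup_emb (v x) : extended H)
}.

(* Equality of the value groups and of the residue fields.                    *)

Definition immediate_vfield (F : fieldType) (G : orderedZmodType)
    (v : valuation F G) (L : fieldType) (H : orderedZmodType)
    (w : valuation L H) (f : vfield_extension v w) : Prop :=
  (forall h : H, exists g : G, vgroup_emb f g = h) /\
  (forall y : L, in_valuation_ring w y ->
    exists2 x : F, in_valuation_ring v x & in_valuation_ideal w (y - f x)).

Definition algebraic_vfield (F : fieldType) (G : orderedZmodType)
    (v : valuation F G) (L : fieldType) (H : orderedZmodType)
    (w : valuation L H) (f : vfield_extension v w) : Prop :=
  forall y : L, algebraicOver f y.

Definition algebraically_maximal (F : fieldType) (G : orderedZmodType)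
    (v : valuation F G) : Prop :=
  forall (L : fieldType) (H : orderedZmodType) (w : valuation L H)
    (f : vfield_extension v w),
  algebraic_vfield f -> immediate_vfield f -> forall y : L, exists x : F, f x = y.

Section OrderedZmodTheory.
Variable G : orderedZmodType.
Implicit Types x y z : G.

Lemma ozmod_ltD2l x : {mono +%R x : y z / y < z}.
Proof. exact: (leW_mono (ozmod_leD2l x)). Qed.

Lemma ozmod_ltD2r x y z : (y + x < z + x) = (y < z).
Proof. by rewrite !(addrC _ x) ozmod_ltD2l. Qed.

Lemma ozmod_leD2r x y z : (y + x <= z + x) = (y <= z).
Proof. by rewrite !(addrC _ x) ozmod_leD2l. Qed.

Lemma ozmod_ltMn x y n : x < y -> x *+ n.+1 < y *+ n.+1.
Proof.
move=> ltxy; elim: n => // n IHn; rewrite !(mulrS _ n.+1).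
by apply: (@lt_trans _ _ (y + x *+ n.+1)); rewrite ?ozmod_ltD2r ?ozmod_ltD2l.
Qed.

Lemma ext_SomeD x y : (Some x : extended G) + Some y = Some (x + y).
Proof. by []. Qed.

Lemma ext_topD (e : extended G) : (\top%O : extended G) + e = \top%O.
Proof. by []. Qed.

Lemma ext_Dtop (e : extended G) : e + (\top%O : extended G) = \top%O.
Proof. by case: e. Qed.

Lemma ext_SomeMn x n : (Some x : extended G) *+ n = Some (x *+ n).
Proof. by elim: n => // n IHn; rewrite !mulrS IHn. Qed.

Lemma ext_topMn n : (0 < n)%N -> (\top%O : extended G) *+ n = \top%O.
Proof. by case: n => // n _; rewrite mulrS. Qed.

Lemma ext_lt_Some x y : ((Some x : extended G) < Some y) = (x < y).
Proof. by rewrite !lt_def. Qed.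

Lemma ext_le_Some x y : ((Some x : extended G) <= Some y) = (x <= y).
Proof. by []. Qed.

Lemma ext_leD2l (e f g : extended G) : f <= g -> e + f <= e + g.
Proof. by case: e f g => [x|] [y|] [z|] //; rewrite !ext_SomeD !ext_le_Some ozmod_leD2l. Qed.

End OrderedZmodTheory.

Section ValuationTheory.
Variables (F : fieldType) (G : orderedZmodType) (v : valuation F G).

Lemma valuation0 : v 0 = \top%O.
Proof. exact/valuation_eq_top. Qed.

Lemma valuation_Some a : a != 0 -> exists x, v a = Some x.
Proof.
move=> a0; case E: (v a) => [x|]; first by exists x.
by move/valuation_eq_top/eqP: E; rewrite (negPf a0).
Qed.

Lemma valuation1 : v 1 = 0.
Proof.
have [x Ex] := valuation_Some (oner_neq0 F).
have := valuationM v 1 1; rewrite mulr1 Ex ext_SomeD => -[] /eqP.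
by rewrite -{1}[x]addr0 (inj_eq (addrI x)) => /eqP <-.
Qed.

Lemma valuationN a : v (- a) = v a.
Proof.
rewrite -mulN1r valuationM; suff -> : v (-1) = 0 by rewrite add0r.
have [| x Ex] := @valuation_Some (-1); first by rewrite oppr_eq0 oner_neq0.
have := valuationM v (-1) (-1); rewrite mulrNN mulr1 valuation1 Ex ext_SomeD => -[] Exx.
have [->|x0] := eqVneq x 0; first by [].
have := ozmod_le_total x 0; rewrite !le_eqVlt [0 == x]eq_sym (negPf x0) /=.
by case/orP=> /(ozmod_ltMn 1); rewrite mul0rn mulr2n -Exx ltxx.
Qed.

End ValuationTheory.

Section AdditivePolynomials.
Variables (p : nat) (F : fieldType) (charFp : p \in [pchar F]).
Local Notation R := (skewpoly (pFrobenius_aut charFp)).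

Definition addpoly (r : R) : {poly F} :=
  \sum_(i < sksize r) skcoef r i *: 'X^(p ^ i).

Lemma addpoly_widen (r : R) n : (sksize r <= n)%N ->
  addpoly r = \sum_(i < n) skcoef r i *: 'X^(p ^ i).
Proof.
move=> ler; rewrite /addpoly.
rewrite (big_ord_widen n (fun i => skcoef r i *: 'X^(p ^ i)) ler) big_mkcond /=.
apply: eq_bigr => i _; case: ltnP => // ger.
by rewrite /skcoef (nth_default 0 ger) scale0r.
Qed.

Lemma addpolyD : {morph addpoly : r s / r + s}.
Proof.
move=> r s; set n := maxn (sksize r) (maxn (sksize s) (sksize (r + s)%R)).
have [n1 n2 n3] :
  [/\ (sksize r <= n), (sksize s <= n) & (sksize (r + s)%R <= n)]%N.
  by rewrite /n !leq_max !leqnn !orbT.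
rewrite (addpoly_widen n1) (addpoly_widen n2) (addpoly_widen n3) -big_split /=.
by apply: eq_bigr => i _; rewrite {1}/skcoef coefD scalerDl.
Qed.

Lemma addpoly0 : addpoly 0 = 0.
Proof. by apply: (addrI (addpoly 0)); rewrite -addpolyD !addr0. Qed.

Lemma addpoly_mono n a : addpoly (skmono _ n a) = a *: 'X^(p ^ n).
Proof.
rewrite (addpoly_widen (sksize_mono _ n a)) big_ord_recr big1 /= => [|i _].
  by rewrite add0r skcoef_mono eqxx.
by rewrite skcoef_mono ltn_eqF // scale0r.
Qed.

Lemma iter_pFrobenius n (x : F) : iter n (pFrobenius_aut charFp) x = x ^+ (p ^ n).
Proof. by elim: n => // n IHn; rewrite iterS IHn pFrobenius_autE -exprM expnSr. Qed.

Lemma addpoly_hornerD r : {morph (fun x => (addpoly r).[x]) : x y / x + y}.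
Proof.
move=> x y; rewrite !horner_sum -big_split /=; apply: eq_bigr => i _.
by rewrite !hornerE -!iter_pFrobenius iter_phiD mulrDr.
Qed.

Lemma addpoly_hornerM r s x : (addpoly (r * s)).[x] = (addpoly s).[(addpoly r).[x]].
Proof.
have h0 u : (addpoly u).[0] = 0.
  by apply: (addrI (addpoly u).[0]); rewrite -addpoly_hornerD !addr0.
elim/skew_ind: r s => [s | r1 r2 IH1 IH2 s | i a].
- by rewrite mul0r addpoly0 horner0 h0.
- by rewrite mulrDl !addpolyD !hornerD addpoly_hornerD IH1 IH2.
elim/skew_ind=> [| s1 s2 IH1 IH2 | j b].
- by rewrite mulr0 addpoly0 !horner0.
- by rewrite mulrDr !addpolyD !hornerD IH1 IH2.
rewrite skmonoM !addpoly_mono !hornerE iter_pFrobenius exprMn -exprM -expnD.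
by rewrite mulrCA mulrA.
Qed.

End AdditivePolynomials.

(* Q(X + Y) = Q(X) + Q(Y) in {poly {poly F}}.                                 *)

Definition additive_polynomial (F : fieldType) (Q : {poly F}) : Prop :=
  poly_XaY Q = Q^:P + Q%:P.

Section AdditivePolynomialTheory.
Variables (p : nat) (F : fieldType) (charFp : p \in [pchar F]).
Local Notation R := (skewpoly (pFrobenius_aut charFp)).

Lemma coef_poly_XaY (Q : {poly F}) i j :
  (poly_XaY Q)`_i`_j = Q`_(i + j) *+ 'C(i + j, i).
Proof.
have XYn k : ('X + 'Y : {poly {poly F}}) ^+ k =
    \sum_(l < k.+1) ('X^(k - l) *+ 'C(k, l)) *: 'X^l.
  rewrite addrC exprDn; apply: eq_bigr => l _.
  by rewrite -polyC_exp mul_polyC -scalerMnl.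
rewrite /poly_XaY comp_polyE !coef_sum.
have E (k : 'I_(size Q^:P)) :
    (Q^:P)`_k *: ('X + 'Y) ^+ k = \sum_(l < k.+1)
      (Q`_k *: ('X^(k - l) *+ 'C(k, l))) *: 'X^l.
  rewrite XYn scaler_sumr; apply: eq_bigr => l _.
  by rewrite coef_map /= scalerA mul_polyC.
have Ec (k : 'I_(size Q^:P)) : ((Q^:P)`_k *: ('X + 'Y) ^+ k)`_i`_j =
    if (i + j == k)%N then Q`_k *+ 'C(k, i) else 0.
  rewrite E !coef_sum.
  have [leik|ltki] := leqP i k; last first.
    rewrite big1 => [|l _]; last first.
      rewrite coefZ coefXn gtn_eqF ?mulr0 ?coef0 //.
      exact: leq_trans (ltn_ord l) ltki.
    by rewrite gtn_eqF // (leq_trans ltki) // leq_addr.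
  have ltik : (i < k.+1)%N by [].
  rewrite (bigD1 (Ordinal ltik)) //= big1 => [|l nel]; last first.
    by rewrite coefZ coefXn [i == _]eq_sym
       (negPf (nel : (l : nat) != i)) mulr0 coef0.
  rewrite addr0 coefZ coefXn eqxx mulr1 coefZ coefMn coefXn.
  rewrite -(eqn_add2l i j) subnKC //.
  by case: eqP; rewrite ?mul0rn ?mulr0 // mulrnAr mulr1.
rewrite (eq_bigr _ (fun k _ => Ec k)) -big_mkcond /=.
have [lt|ge] := ltnP (i + j) (size Q^:P).
  by rewrite (big_pred1 (Ordinal lt)).
rewrite big1 => [|k /eqP Ek]; last by have := ltn_ord k; rewrite -Ek ltnNge ge.
by rewrite nth_default ?mul0rn // -(size_map_polyC Q).
Qed.

Lemma additive_coef0 (Q : {poly F}) i j : additive_polynomial Q ->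
  (0 < i)%N -> (0 < j)%N -> Q`_(i + j) *+ 'C(i + j, i) = 0.
Proof.
move=> addQ i0 j0; rewrite -coef_poly_XaY addQ coefD coef_map coefC.
by rewrite (gtn_eqF i0) addr0 coefC (gtn_eqF j0).
Qed.

Lemma bin_pfactor_neq0 k u : (0 < u)%N -> ~~ (p %| u)%N ->
  'C(p ^ k * u, p ^ k)%:R != 0 :> F.
Proof.
move=> u0 ndv; have p_pr := pcharf_prime charFp.
have pk0 : (0 < p ^ k)%N by rewrite expn_gt0 prime_gt0.
have E : (1 + 'X : {poly F}) ^+ (p ^ k * u) = (1 + 'X^(p ^ k)) ^+ u.
  rewrite exprM exprDn_pchar ?expr1n //.
  rewrite pnatX; apply/orP; left.
  by rewrite pnatE // pchar_poly.
have := congr1 (fun q : {poly F} => q`_(p ^ k)) E.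
rewrite !exprDn !coef_sum.
rewrite (bigD1 (inord (p ^ k))) //= inordK; last first.
  by rewrite ltnS leq_pmulr.
rewrite big1 => [|l nel]; last first.
  rewrite expr1n mul1r coefMn coefXn; case: eqP => [El|_]; last exact: mul0rn.
  by case/eqP: nel; apply: val_inj; rewrite /= inordK ?ltnS ?leq_pmulr.
rewrite (bigD1 (inord 1)) //= inordK; last by rewrite ltnS.
rewrite big1 => [|l nel]; last first.
  rewrite expr1n mul1r coefMn -exprM coefXn; case: eqP => [El|_]; last exact: mul0rn.
  case/eqP: nel; apply: val_inj; rewrite /= inordK ?ltnS //.
  by move/eqP: El; rewrite -[X in X == _]muln1 eqn_pmul2l // => /eqP.
rewrite !addr0 !expr1n !mul1r !coefMn !coefXn eqxx bin1 => ->.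
by rewrite -(dvdn_pcharf charFp).
Qed.

Lemma additive_polynomialP (Q : {poly F}) :
  additive_polynomial Q <-> exists r : R, addpoly r = Q.
Proof.
have p_pr := pcharf_prime charFp.
split=> [addQ | [r <-]]; last first.
  rewrite /additive_polynomial; elim/skew_ind: r => [|r s IHr IHs|n a].
  - by rewrite addpoly0 poly_XaY0 polyC0 addr0 rmorph0.
  - rewrite addpolyD /poly_XaY rmorphD /= comp_polyD -!/(poly_XaY _) IHr IHs.
    by rewrite polyCD addrACA.
  rewrite addpoly_mono /poly_XaY map_polyZ /= map_polyXn comp_polyZ.
  rewrite comp_Xn_poly exprDn_pchar.
    by rewrite scalerDr -rmorphXn /= -[_ *: _%:P]mul_polyC -polyCM mul_polyC.
  by rewrite pnatX pnatE // !pchar_poly charFp.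
have Q0 n : (forall k, n != p ^ k)%N -> Q`_n = 0.
  move=> nX; have [->|n0] := posnP n.
    have := coef_poly_XaY Q 0 0; rewrite addQ coefD coef_map coefC /= bin0 mulr1n.
    rewrite coefD !coefC /= => /eqP.
    by rewrite -{3}[Q`_0]addr0 (inj_eq (addrI _)) => /eqP.
  have [u ndv En] := pfactor_coprime p_pr n0.
  move: ndv; rewrite prime_coprime // => ndv.
  have u1 : (1 < u)%N.
    case: u ndv En nX => [|[|u]] //; first by rewrite dvdn0.
    by move=> _ -> /(_ (logn p n)); rewrite mul1n lognE; rewrite eqxx.
  have := additive_coef0 addQ (i := p ^ logn p n) (j := p ^ logn p n * u.-1).
  have En' : (p ^ logn p n * u = n)%N by rewrite mulnC -En.
  rewrite -mulnS prednK ?(ltnW u1) // En'.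
  rewrite expn_gt0 prime_gt0 //= => /(_ isT).
  have -> : (0 < p ^ logn p n * u.-1)%N.
    by rewrite muln_gt0 expn_gt0 prime_gt0 // -ltnS prednK // (ltnW u1).
  move=> /(_ isT) /eqP; rewrite -mulr_natr mulf_eq0 => /orP[/eqP //|].
  have := bin_pfactor_neq0 (logn p n) (ltnW u1) ndv.
  by rewrite En' => /negPf ->.
exists (\sum_(k < size Q) skmono _ k Q`_(p ^ k)).
rewrite (big_morph _ (@addpolyD p F charFp) (addpoly0 charFp)).
rewrite (eq_bigr _ (fun (k : 'I__) _ => addpoly_mono charFp k Q`_(p ^ k))).
apply/polyP => n; rewrite coef_sum.
have [/existsP[k /eqP En]|] := boolP [exists k : 'I_(size Q), n == p ^ k]%N.
  rewrite (bigD1 k) //= big1 => [|l nel].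
    by rewrite coefZ coefXn -En eqxx mulr1 addr0.
  rewrite coefZ coefXn En eqn_exp2l ?prime_gt1 // eq_sym.
  by rewrite (negPf (nel : (l : nat) != k)) mulr0.
rewrite negb_exists => /forallP nX; rewrite big1 => [|l _]; last first.
  by rewrite coefZ coefXn (negPf (nX l)) mulr0.
have [ge|lt] := leqP (size Q) n; first by rewrite nth_default.
rewrite Q0 // => k; apply/eqP=> En.
have ltk : (k < size Q)%N.
  by apply: leq_ltn_trans lt; rewrite En ltnW // ltn_expl ?prime_gt1.
by have := nX (Ordinal ltk); rewrite /= -En eqxx.
Qed.

End AdditivePolynomialTheory.

(* F as a right module over R = F[t; x |-> x^p], by x.r = \sum_i a_i x^(p^i). *)

Definition frobenius_module (p : nat) (F : fieldType)
    (charFp : p \in [pchar F]) : Type := F.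

Section FrobeniusModule.
Variables (p : nat) (F : fieldType) (charFp : p \in [pchar F]).
Local Notation R := (skewpoly (pFrobenius_aut charFp)).
Local Notation M := (frobenius_module charFp).

HB.instance Definition _ := GRing.Zmodule.on M.

Definition frobenius_scale (r : R^c) (x : M) : M :=
  (addpoly (r : R)).[x : F].

Fact frobenius_scaleA (r s : R^c) (x : M) :
  frobenius_scale r (frobenius_scale s x) = frobenius_scale (r * s) x.
Proof. by rewrite /frobenius_scale -addpoly_hornerM. Qed.

Fact frobenius_scale1 : left_id 1 frobenius_scale.
Proof.
by move=> x; rewrite /frobenius_scale addpoly_mono scale1r hornerXn expr1.
Qed.

Fact frobenius_scaleDr : right_distributive frobenius_scale +%R.
Proof. by move=> r x y; rewrite /frobenius_scale -addpoly_hornerD. Qed.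

Fact frobenius_scaleDl (x : M) :
  {morph frobenius_scale^~ x : r s / r + s}.
Proof. by move=> r s; rewrite /frobenius_scale addpolyD hornerD. Qed.

HB.instance Definition _ := GRing.Zmodule_isLmodule.Build R^c M
  frobenius_scaleA frobenius_scale1 frobenius_scaleDr frobenius_scaleDl.

End FrobeniusModule.

Section ValuedField.
Variables (p : nat) (F : fieldType) (G : orderedZmodType).
Variables (charFp : p \in [pchar F]) (v : valuation F G).
Local Notation phi := (pFrobenius_aut charFp : {rmorphism F -> F}).
Local Notation R := (skewpoly phi).
Local Notation M := (frobenius_module charFp).
Local Notation E := (extended G).

Definition value_act (g : E) (r : R) : E :=
  \big[Order.min / \top%O]_(i < sksize r | skcoef r i != 0)
     (g *+ (p ^ i) + v (skcoef r i)).

Lemma value_act_mono g n a : a != 0 ->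
  value_act g (skmono phi n a) = g *+ (p ^ n) + v a.
Proof.
move=> a0; rewrite /value_act.
have En : sksize (skmono phi n a) = n.+1.
  by rewrite /sksize /skmono size_scale // size_polyXn.
have ltn : (n < sksize (skmono phi n a))%N by rewrite En.
rewrite (bigminD1 (Ordinal ltn)) /= skcoef_mono eqxx // big1_idem ?minxx //; first exact: min_idPl (lex1 _).
move=> i.
case/andP=> + nei; rewrite skcoef_mono.
by rewrite (negPf (nei : (i : nat) != n)) eqxx.
Qed.

Lemma value_act0 g : value_act g 0 = \top%O.
Proof. by rewrite /value_act big_pred0 // => i; rewrite /skcoef coef0 eqxx. Qed.

Lemma value_act_scal g a : value_act g (skC phi a) = g + v a.
Proof.
have [->|a0] := eqVneq a 0; last by rewrite value_act_mono.
rewrite valuation0 ext_Dtop -(value_act0 g); congr (value_act g _).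
by rewrite /skC /skmono scale0r.
Qed.

Lemma value_act_t g : value_act g (skT phi) = g *+ p.
Proof. by rewrite value_act_mono ?oner_neq0 // valuation1 addr0. Qed.

Lemma p_gt0 : (0 < p)%N.
Proof. exact/prime_gt0/(pcharf_prime charFp). Qed.

Fact value_act_chain : is_chain value_act.
Proof.
have p0 := p_gt0; have pX n : (0 < p ^ n)%N by rewrite expn_gt0 p0.
split.
- move=> a [x|] // [y|] // /(valuation_Some v)[z Ez] _ _; rewrite !value_act_scal Ez.
  by rewrite !ext_SomeD !ext_lt_Some ozmod_ltD2r.
- by move=> a b g _ _ _; rewrite !value_act_scal valuationM addrA.
- move=> a [x|] // [y|] // /(valuation_Some v)[z Ez] _ _; rewrite !value_act_scal Ez.
  have aux w : (w < w + z) = (0 < z) by rewrite -{1}[w]addr0 ozmod_ltD2l.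
  by rewrite !ext_SomeD !ext_lt_Some !aux.
- move=> a b g _ _ _; rewrite !value_act_scal.
  apply: le_trans (ext_leD2l g (valuationD v a b)).
  by case: (leP (v a) (v b)); rewrite ge_min lexx ?orbT.
- move=> a b g _ _ _; rewrite !value_act_scal -(valuationN v b).
  apply: le_trans (ext_leD2l g (valuationD v a (- b))).
  by case: (leP (v a) (v (- b))); rewrite ge_min lexx ?orbT.
- exact: value_act0.
- by move=> g; rewrite value_act_scal valuation1 addr0.
- by move=> b; rewrite value_act_scal.
- move=> [x|] // [y|] // _ _; rewrite !value_act_t !ext_SomeMn !ext_lt_Some.
  by rewrite -(prednK p0); apply: ozmod_ltMn.
- by rewrite value_act_t ext_topMn.
- move=> a g a0; rewrite skmonoM /= mul1r value_act_mono // value_act_scal.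
  by rewrite value_act_t.
- move=> n a g a0; rewrite !skT_exp !skmonoM /= !mul1r !addn0.
  rewrite !value_act_mono ?oner_neq0 //.
  by rewrite valuation1 addr0 -mulrnA -expnD addn1.
- by move=> r g _; apply: eq_bigr => i ri0; rewrite value_act_mono.
- move=> i j a b [x|] // [y|] // a0 b0 ltji _; rewrite !value_act_mono //.
  have [[al ->] [be ->]] := (valuation_Some v a0, valuation_Some v b0).
  rewrite !ext_SomeMn !ext_SomeD ext_le_Some !ext_lt_Some.
  have /subnKC <- : (p ^ j < p ^ i)%N.
    by rewrite ltn_exp2l // prime_gt1 // (pcharf_prime charFp).
  set m := (p ^ j)%N; set n := (_ - m.+1)%N; rewrite addSnnS.
  rewrite !(mulrnDr _ m) -!addrA ozmod_leD2l ozmod_ltD2l => le_al lt_yx.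
  by apply: lt_le_trans le_al; rewrite ozmod_ltD2r ozmod_ltMn.
Qed.

Definition value_chain : chain phi := Chain value_act_chain.

Definition field_val (x : M) : value_chain := v (x : F).

Fact field_val_axioms : is_valued_module field_val.
Proof.
split.
- exact: valuation_surj.
- exact: valuationD.
- by move=> x y; rewrite -[field_val y](valuationN v); apply: valuationD.
- exact: valuation_eq_top.
- move=> x a; rewrite /ract /= value_act_scal -valuationM; congr (v _).
  by rewrite /GRing.scale /= /frobenius_scale addpoly_mono hornerZ hornerXn mulrC.
- move=> x; rewrite /ract /= value_act_t.
  rewrite /field_val /GRing.scale /= /frobenius_scale addpoly_mono scale1r.
  rewrite hornerXn expn1; elim: p => [|n IHn]; first by rewrite expr0 valuation1.
  by rewrite exprS valuationM IHn mulrS.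
Qed.

Definition field_valued_module : valued_module phi :=
  ValuedModule field_val_axioms.

End ValuedField.

Definition has_max (G : orderedZmodType) (S : extended G -> Prop) : Prop :=
  exists2 m, S m & forall g, S g -> g <= m.

(* Main.v *)
From HB Require Import structures.
Require Import Defs.
From mathcomp Require Import all_boot all_order all_algebra.
From mathcomp Require Import fingroup all_field.
From mathcomp Require Import ring.
From mathcomp Require Import boolp.
From mathcomp Require classical_sets.

Set Implicit Arguments.
Unset Strict Implicit.
Unset Printing Implicit Defensive.

Import Order.TTheory GRing.Theory Num.Theory.
Local Open Scope ring_scope.

(**
  The implications 1 -> 2 and 3 -> 4 are direct, 2 -> 3 is Kaplansky's
  construction of immediate extensions, and 4 -> 1 carries the use of additive
  polynomials.

  1 -> 2.  An algebraic extension L of F is a right R-module through the maps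
  x |-> Q(x), Q additive.  Every nonzero P over F divides a nonzero additive
  polynomial, because the X^(p^i) are linearly dependent modulo P
  ([additive_multiple]); hence each y in L is killed by a nonzero element of R
  and L is affine over F.  If L|F is immediate as an extension of valued fields
  it is immediate as an extension of valued modules, so L = F.

  2 -> 3.  Call z in a valued extension badly approximable if the values
  v(z - a), a in F, have no maximum.  If no root of P is badly approximable then
  v(P(a)) attains its maximum at one of the best approximations of the roots
  ([best_approx_attains_max]).  Otherwise take a badly approximable algebraic z
  of least degree n.  The roots of a polynomial g of lower degree all have best
  approximations, so g(a) is asymptotic to g(z) for a in F near z
  ([horner_approx]).  As the elements of F(z) are of the form g(z), each of them
  is asymptotic to an element of F, i.e. F(z) is immediate over F, and v extends
  to F(z) with the same value group ([immediate_valuation]).  By 2, z lies in F,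
  which a badly approximable element does not.

  4 -> 1.  Let N be an affine immediate extension of F, x in N outside F and
  x.r = y in F with r nonzero; let Q be the additive polynomial of r.  If r = t s
  then by induction on the degree x.t lies in F, and 4 for X^p gives x in F.
  Otherwise Q - y is separable, with a splitting field L, Galois over F; as F is
  henselian, the Galois group preserves any extension w of v to L
  ([henselian_gal_valring]).  The distances v(x - a), a in F, have no maximum,
  and v(Q(a) - y) = v((x - a).r) is at least the minimum of the values of the
  monomials of r at v(x - a).  The Newton polygon of Q(a + X) - y then provides a
  root t of Q - y with w(t - a) >= v(x - a), and by finiteness one root works for
  all a.  The set T of all such roots is stable under the Galois group, and it is
  a coset of an additive group since Q is additive.  Hence the product f of the
  X - t, t in T, has coefficients in F and is of the form A - b with A additive,
  and v(f(a)) = |T| v(x - a) has no maximum, against 4 ([approx_data_no_max]).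

  Extensions of v are handled through their valuation rings and the preorder
  w(x) <= w(y), so that no value group has to be built for them.  Their existence
  is Chevalley's theorem ([valring_extension]).
*)

(** * Valuation rings and their dominance preorder *)

Record valring (E : fieldType) := Valring {
  vr_mem :> pred E;
  vr1 : vr_mem 1;
  vrB : forall x y, vr_mem x -> vr_mem y -> vr_mem (x - y);
  vrM : forall x y, vr_mem x -> vr_mem y -> vr_mem (x * y);
  vrV : forall x, vr_mem x || vr_mem x^-1
}.

Section ValringTheory.
Variables (E : fieldType) (O : valring E).
Implicit Types x y z t : E.

(** The relation w(x) <= w(y), for a valuation w with ring O and w(0) the top. *)
Definition wle x y := (y == 0) || (x != 0) && O (y / x).
Definition wlt x y := ~~ wle y x.

Lemma vr0 : O 0.
Proof. by rewrite -(subrr 1); apply: vrB; apply: vr1. Qed.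

Lemma vrN x : O x -> O (- x).
Proof. by move=> Ox; rewrite -sub0r; apply: vrB => //; apply: vr0. Qed.

Lemma vrD x y : O x -> O y -> O (x + y).
Proof. by move=> Ox Oy; rewrite -(opprK y); apply: vrB => //; apply: vrN. Qed.

Lemma wle1 x : wle 1 x = O x.
Proof.
rewrite /wle oner_eq0 divr1 /=.
by case: eqVneq => [->|_] /=; rewrite ?vr0.
Qed.

Lemma wlexx x : wle x x.
Proof. by rewrite /wle; case: eqVneq => //= x0; rewrite divff // vr1. Qed.

Lemma wlex0 x : wle x 0.
Proof. by rewrite /wle eqxx. Qed.

Lemma wle0x x : wle 0 x = (x == 0).
Proof. by rewrite /wle eqxx /= orbF. Qed.

Lemma wle_trans y x z : wle x y -> wle y z -> wle x z.
Proof.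
rewrite /wle => /predU1P[->|/andP[x0 Oyx]]; first by rewrite eqxx /= orbF => ->.
case: (eqVneq z 0) => //= _; rewrite x0 /= => /andP[y0 Ozy].
by have := vrM Ozy Oyx; rewrite mulrA divfK.
Qed.

Lemma wle_total x y : wle x y || wle y x.
Proof.
rewrite /wle; case: (eqVneq x 0) => [->|x0] /=; first by rewrite orbT.
by case: (eqVneq y 0) => //= y0; rewrite -[x / y]invf_div vrV.
Qed.

Lemma wltW x y : wlt x y -> wle x y.
Proof. by move=> lxy; have := wle_total x y; rewrite (negPf lxy) orbF. Qed.

Lemma wle_lt_trans y x z : wle x y -> wlt y z -> wlt x z.
Proof. by move=> lxy; apply: contra => lzx; apply: wle_trans lzx lxy. Qed.

Lemma wlt_le_trans y x z : wlt x y -> wle y z -> wlt x z.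
Proof. by move=> lxy lyz; apply: contra lxy => lzx; apply: wle_trans lyz lzx. Qed.

Lemma wltx0 x : wlt x 0 = (x != 0).
Proof. by rewrite /wlt wle0x. Qed.

Lemma wlt_neq0 x y : wlt x y -> x != 0.
Proof. by apply: contraNneq => ->; apply: wlex0. Qed.

Lemma wleN x y : wle x (- y) = wle x y.
Proof.
rewrite /wle oppr_eq0 mulNr; case: eqP => //= _; congr (_ && _).
by apply/idP/idP => /vrN //; rewrite opprK.
Qed.

Lemma wNle x y : wle (- x) y = wle x y.
Proof. by rewrite -wleN /wle !oppr_eq0 invrN mulrNN. Qed.

Lemma wleD z x y : wle z x -> wle z y -> wle z (x + y).
Proof.
have [->|z0] := eqVneq z 0; first by rewrite !wle0x => /eqP-> /eqP->; rewrite addr0.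
rewrite {1 2}/wle z0 /=.
case/predU1P=> [->|Ox]; first by rewrite add0r /wle z0.
case/predU1P=> [->|Oy]; first by rewrite addr0 /wle z0 Ox orbT.
by rewrite /wle z0 mulrDl vrD ?orbT.
Qed.

Lemma wltD z x y : wlt z x -> wlt z y -> wlt z (x + y).
Proof.
move=> zx zy; case/orP: (wle_total x y) => lxy.
  by apply: wlt_le_trans zx _; apply: wleD => //; apply: wlexx.
by apply: wlt_le_trans zy _; apply: wleD => //; apply: wlexx.
Qed.

Lemma wleBC t x y : wle t (x - y) = wle t (y - x).
Proof. by rewrite -opprB wleN. Qed.

Lemma wBCle x y t : wle (x - y) t = wle (y - x) t.
Proof. by rewrite -opprB wNle. Qed.

Lemma wle_tri y t x z : wle t (x - y) -> wle t (y - z) -> wle t (x - z).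
Proof. by move=> xy yz; rewrite -[x](subrK y) -addrA; apply: wleD. Qed.

Lemma wlt_tri y t x z : wlt t (x - y) -> wlt t (y - z) -> wlt t (x - z).
Proof. by move=> xy yz; rewrite -[x](subrK y) -addrA; apply: wltD. Qed.

Lemma wle_addl x y : wlt x y -> wle (x + y) x.
Proof.
move=> lxy; case/orP: (wle_total (x + y) x) => // lxs.
have: wle (x + y) (x + y - y).
  apply: wleD; rewrite ?wlexx // wleN.
  case/orP: (wle_total (x + y) y) => // ly; case/negP: lxy.
  rewrite -[X in wle y X](addrK y); apply: wleD => //.
  by rewrite wleN wlexx.
by rewrite addrK.
Qed.

Lemma wle_sub_lt x y : wlt x (x - y) -> wle x y /\ wle y x.
Proof.
move=> lx; split.
  by rewrite -[y](subKr x); apply: wleD; rewrite ?wlexx // wleN; apply: wltW.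
have := wle_addl (x := x) (y := y - x); rewrite subrKC; apply.
by rewrite /wlt wBCle.
Qed.

Lemma wleM x y x' y' : wle x y -> wle x' y' -> wle (x * x') (y * y').
Proof.
rewrite {1 2}/wle => /predU1P[->|/andP[x0 Oxy]].
  by rewrite mul0r => _; apply: wlex0.
case/predU1P=> [->|/andP[x0' Oxy']]; first by rewrite mulr0 wlex0.
by rewrite /wle mulf_neq0 // -mulf_div; apply/orP; right; apply: vrM.
Qed.

Lemma wle_pM2l z x y : z != 0 -> wle (z * x) (z * y) = wle x y.
Proof.
move=> z0; apply/idP/idP => [|lxy]; last by apply: wleM => //; apply: wlexx.
by move/(wleM (wlexx z^-1)); rewrite !mulrA mulVf // !mul1r.
Qed.

Lemma wltM x y x' y' : x' != 0 -> wlt x y -> wle x' y' -> wlt (x * x') (y * y').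
Proof.
move=> x0 lxy lxy'; apply: wlt_le_trans (_ : wle (y * x') _).
  by rewrite /wlt !(mulrC _ x') wle_pM2l.
by apply: wleM => //; apply: wlexx.
Qed.

Lemma wle_pM2r z x y : z != 0 -> wle (x * z) (y * z) = wle x y.
Proof. by rewrite !(mulrC _ z); apply: wle_pM2l. Qed.

Lemma wle_prod (I : eqType) (s : seq I) (f g : I -> E) :
  {in s, forall i, wle (f i) (g i)} ->
  wle (\prod_(i <- s) f i) (\prod_(i <- s) g i).
Proof.
elim: s => [|i s IHs] lefg; first by rewrite !big_nil wlexx.
rewrite !big_cons; apply: wleM; first by apply: lefg; rewrite mem_head.
by apply: IHs => j sj; apply: lefg; rewrite inE sj orbT.
Qed.

Lemma wle_argmax (I : eqType) (f : I -> E) (i0 : I) (s : seq I) :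
  exists2 i, i \in i0 :: s & {in i0 :: s, forall j, wle (f j) (f i)}.
Proof.
elim: s i0 => [|j s IHs] i0.
  by exists i0 => [|j]; rewrite ?mem_head // inE => /eqP->; apply: wlexx.
have [i si imax] := IHs j.
case/orP: (wle_total (f i0) (f i)) => l.
  exists i => [|k]; first by rewrite in_cons si orbT.
  by rewrite in_cons => /predU1P[->//|/imax].
exists i0 => [|k]; first exact: mem_head.
rewrite in_cons => /predU1P[->|/imax]; first exact: wlexx.
by move/wle_trans; apply.
Qed.

End ValringTheory.

Arguments wle_trans {E O} y {x z}.
Arguments wle_tri {E O} y {t x z}.
Arguments wlt_tri {E O} y {t x z}.
Arguments wle_lt_trans {E O} y {x z}.
Arguments wlt_le_trans {E O} y {x z}.

Section ValringOfValuation.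
Variables (F : fieldType) (G : orderedZmodType) (v : valuation F G).

Fact in_valuation_ringB x y : in_valuation_ring v x -> in_valuation_ring v y ->
  in_valuation_ring v (x - y).
Proof.
rewrite /in_valuation_ring => vx vy; apply: le_trans (valuationD v x (- y)).
by rewrite le_min vx valuationN.
Qed.

Fact in_valuation_ringM x y : in_valuation_ring v x -> in_valuation_ring v y ->
  in_valuation_ring v (x * y).
Proof.
rewrite /in_valuation_ring => vx vy; rewrite valuationM; apply: le_trans vx _.
by rewrite -{1}[v x]addr0; apply: ext_leD2l.
Qed.

Fact in_valuation_ring1 : in_valuation_ring v 1.
Proof. by rewrite /in_valuation_ring valuation1. Qed.

Fact in_valuation_ringV x : in_valuation_ring v x || in_valuation_ring v x^-1.
Proof.
rewrite /in_valuation_ring; have [->|x0] := eqVneq x 0.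
  by rewrite valuation0 lex1.
have vxV : v x + v x^-1 = 0 by rewrite -valuationM divff // valuation1.
case: (leP (0 : extended G) (v x)) => //= /ltW lvx.
by rewrite -vxV addrC -{2}[v x^-1]addr0; apply: ext_leD2l.
Qed.

Definition valring_of : valring F :=
  Valring in_valuation_ring1 in_valuation_ringB in_valuation_ringM
    in_valuation_ringV.

Lemma wle_valring_of x y : wle valring_of x y = (v x <= v y).
Proof.
rewrite /wle; case: (eqVneq y 0) => [->|y0] /=; first by rewrite valuation0 lex1.
case: (eqVneq x 0) => [->|x0] /=.
  by rewrite valuation0 le1x; apply/esym/negbTE/eqP => /valuation_eq_top/eqP/negPn;
     rewrite y0.
rewrite /in_valuation_ring valuationM.
have vxV : v x + v x^-1 = 0 by rewrite -valuationM divff // valuation1.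
apply/idP/idP => /ext_leD2l le.
  by have := le (v x); rewrite addr0 addrCA vxV addr0.
by have := le (v x^-1); rewrite addrC vxV addrC.
Qed.

Lemma wlt_valring_of x y : wlt valring_of x y = (v x < v y).
Proof. by rewrite /wlt wle_valring_of -ltNge. Qed.

End ValringOfValuation.

(** * Extending valuation rings along field embeddings *)

Lemma wle_map (K E : fieldType) (iota : {rmorphism K -> E}) (O : valring K)
    (O' : valring E) : (forall x, O' (iota x) = O x) ->
  forall x y, wle O' (iota x) (iota y) = wle O x y.
Proof. by move=> ext x y; rewrite /wle !fmorph_eq0 -fmorph_div ext. Qed.

Section Chevalley.
Variables (K E : fieldType) (iota : {rmorphism K -> E}) (O : valring K).

(** The subrings of E whose trace on K is O; a maximal one will be a valuation
    ring of E. *)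
Record overring (A : E -> Prop) : Prop := Overring {
  overring_img : forall x, O x -> A (iota x);
  overringB : forall x y, A x -> A y -> A (x - y);
  overringM : forall x y, A x -> A y -> A (x * y);
  overring_contr : forall x, A (iota x) -> O x
}.

Section Overring.
Variables (A : E -> Prop) (ovA : overring A).

Let A1 : A 1.
Proof. by rewrite -(rmorph1 iota); apply/(overring_img ovA)/vr1. Qed.

Let A0 : A 0.
Proof. by rewrite -(subrr 1); apply: (overringB ovA). Qed.

Let AD x y : A x -> A y -> A (x + y).
Proof.
move=> Ax Ay; rewrite -[y]opprK; apply: (overringB ovA) => //.
by rewrite -sub0r; apply: (overringB ovA).
Qed.

Let Asum (I : Type) (s : seq I) (f : I -> E) :
  (forall i, A (f i)) -> A (\sum_(i <- s) f i).
Proof. by move=> Af; apply: big_ind. Qed.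

Definition adjoin (y z : E) : Prop :=
  exists2 p : {poly E}, forall i, A p`_i & z = p.[y].

Lemma adjoin_sub y z : A z -> adjoin y z.
Proof.
move=> Az; exists z%:P; last by rewrite hornerC.
by move=> i; rewrite coefC; case: ifP.
Qed.

Lemma adjoin_gen y : adjoin y y.
Proof.
exists 'X; last by rewrite hornerX.
by move=> i; rewrite coefX; case: (_ == _).
Qed.

Lemma adjoinB y z t : adjoin y z -> adjoin y t -> adjoin y (z - t).
Proof.
move=> [p Ap ->] [q Aq ->]; exists (p - q); last by rewrite hornerD hornerN.
by move=> i; rewrite coefB; apply: (overringB ovA).
Qed.

Lemma adjoinM y z t : adjoin y z -> adjoin y t -> adjoin y (z * t).
Proof.
move=> [p Ap ->] [q Aq ->]; exists (p * q); last by rewrite hornerM.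
by move=> i; rewrite coefM; apply: Asum => j; apply: (overringM ovA).
Qed.

(** A witness that the trace of A[y] on K exceeds O; the bound n is what
    decreases in the elimination between the relations for x and x^-1. *)
Definition breaks (n : nat) (y : E) (d : K) : Prop :=
  ~~ O d /\ exists p : {poly E},
    [/\ forall i, A p`_i, (size p <= n)%N & iota d = p.[y]].

Lemma breaks_scale n y d e : ~~ O d -> O (d / e) -> breaks n y e -> breaks n y d.
Proof.
move=> Od Ode [Oe [p [Ap szp De]]]; split=> //; exists (iota (d / e) *: p); split.
- move=> i; rewrite coefZ; apply: (overringM ovA) => //.
  exact: (overring_img ovA).
- exact: leq_trans (size_scale_leq _ _) szp.
rewrite hornerZ -De -rmorphM divfK //.
by apply: contraNneq Oe => ->; apply: vr0.
Qed.

Lemma breaks_common n m x y d e : breaks n x d -> breaks m y e ->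
  exists2 f, breaks n x f & breaks m y f.
Proof.
move=> bd be; have := vrV O (d / e); rewrite invf_div => /orP[ode|oed].
  by exists d => //; apply: breaks_scale ode be; case: bd.
by exists e => //; apply: breaks_scale oed bd; case: be.
Qed.

(** Multiplying the relation for x^-1 by x^n expresses (1 - q_0 / d) x^n through
    lower powers of x; this replaces the top power in 1 - q_0 / d times the
    relation for x.  The divisions by d stay in A because d^-1 lies in O. *)
Lemma breaks_reduce n x d : breaks n.+1 x d -> breaks n.+1 x^-1 d ->
  breaks n x d.
Proof.
move=> [Od [p [Ap szp Dp]]] [_ [q [Aq szq Dq]]].
have d0 : d != 0 by apply: contraNneq Od => ->; apply: vr0.
set D := iota d in Dp Dq *; have D0 : D != 0 by rewrite fmorph_eq0.
have ADV : A D^-1.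
  rewrite -fmorphV; apply: (overring_img ovA).
  by have := vrV O d; rewrite (negPf Od).
have x0 : x != 0.
  apply: contraNneq Od => x0; apply: (overring_contr ovA); rewrite -/D Dp x0.
  by rewrite horner_coef0.
split=> //; exists (\poly_(i < n) ((if i == 0 then q`_0 else 0)
  + (1 - q`_0 / D) * p`_i + p`_n / D * q`_(n - i))); split.
- move=> i; rewrite coef_poly; case: ifP => // _.
  apply: AD; last by do 2?apply: (overringM ovA).
  apply: AD; first by case: (i == 0).
  by apply: (overringM ovA) => //; apply: (overringB ovA) => //; apply: (overringM ovA).
- exact: size_poly.
have n0 : (0 < n)%N.
  rewrite lt0n; apply: contraNneq Od => n0; apply: (overring_contr ovA).
  rewrite -/D Dp; move: szp; rewrite n0 => /size1_polyC->.
  by rewrite hornerC.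
rewrite horner_poly.
under eq_bigr do rewrite !mulrDl -!mulrA.
rewrite !big_split /= -!mulr_sumr.
have -> : \sum_(i < n) (if i == 0 :> nat then q`_0 else 0) * x ^+ i = q`_0.
  rewrite -(prednK n0) big_ord_recl /= expr0 mulr1 big1 ?addr0 // => i _.
  by rewrite mul0r.
have Ep : D = \sum_(i < n) p`_i * x ^+ i + p`_n * x ^+ n.
  by rewrite Dp (horner_coef_wide _ szp) big_ord_recr.
have Eq : \sum_(i < n) q`_(n - i) * x ^+ i = x ^+ n * (D - q`_0).
  rewrite Dq (horner_coef_wide _ szq) big_ord_recl expr0 mulr1 addrC addKr.
  rewrite mulr_sumr (reindex_inj rev_ord_inj) /=; apply: eq_bigr => i _.
  rewrite subKn // exprVn mulrCA; congr (_ * _).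
  rewrite /bump leq0n add1n; apply: (mulIf (expf_neq0 i.+1 x0)).
  by rewrite -exprD subnK // divfK // expf_neq0.
rewrite Eq.
have -> : \sum_(i < n) p`_i * x ^+ i = D - p`_n * x ^+ n by rewrite Ep addrK.
by field.
Qed.

Hypothesis maxA : forall B, overring B -> (forall z, A z -> B z) -> forall z, B z -> A z.

Lemma maximal_breaks y : ~ A y -> exists n, exists d, breaks n y d.
Proof.
move=> nAy; apply: contrapT => nb; apply: nAy.
apply: (maxA (B := adjoin y)); [split | exact: adjoin_sub | exact: adjoin_gen].
- by move=> x Ox; apply/adjoin_sub/(overring_img ovA).
- exact: adjoinB.
- exact: adjoinM.
move=> x [p Ap Dx]; apply: contrapT => /negP nOx.
by apply: nb; exists (size p), x; split=> //; exists p.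
Qed.

Lemma maximal_overring_inv x : A x \/ A x^-1.
Proof.
apply: contrapT => /not_orP[nAx nAxV].
have least y : ~ A y -> exists2 n, exists d, breaks n y d &
    forall m d, breaks m y d -> (n <= m)%N.
  move=> /maximal_breaks exn; pose P n := `[< exists d, breaks n y d >].
  have exP : exists n, P n by case: exn => n bn; exists n; apply/asboolP.
  case: (ex_minnP exP) => n /asboolP bn minn; exists n => // m d bm.
  by apply: minn; apply/asboolP; exists d.
wlog: x nAx nAxV / exists n m d, [/\ breaks n x d, breaks m x^-1 d, (m <= n)%N &
    forall k e, breaks k x e -> (n <= k)%N].
  have [n [d bn] minn] := least _ nAx; have [m [e bm] minm] := least _ nAxV.
  have [f bnf bmf] := breaks_common bn bm.
  move=> IH; case/orP: (leq_total m n) => lmn.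
    by apply: (IH x) => //; exists n, m, f.
  by apply: (IH x^-1); rewrite ?invrK //; exists m, n, f.
move=> [[|n] [m [d [bn [Om [q [Aq szq Dq]]] lmn minn]]]].
  case: bn => Od [p [_ szp Dd]]; case/negP: Od.
  by move: Dd; rewrite size_poly_leq0 in szp; rewrite (eqP szp) horner0 => /eqP;
     rewrite fmorph_eq0 => /eqP->; apply: vr0.
have /minn : breaks n x d; last by rewrite ltnn.
apply: breaks_reduce => //; split=> //; exists q; split=> //.
exact: leq_trans lmn.
Qed.

End Overring.

Lemma maximal_overring : exists2 A, overring A &
  forall B, overring B -> (forall z, A z -> B z) -> forall z, B z -> A z.
Proof.
pose A0 z := exists2 x, O x & z = iota x.
have ovA0 : overring A0.
  split=> [x Ox|_ _ [x Ox ->] [y Oy ->]|_ _ [x Ox ->] [y Oy ->]|x [y Oy /fmorph_inj->//]].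
  - by exists x.
  - by exists (x - y); rewrite ?rmorphB //; apply: vrB.
  - by exists (x * y); rewrite ?rmorphM //; apply: vrM.
(* The empty set is admitted so that the empty chain has an upper bound. *)
pose P (X : classical_sets.set E) := (forall z, ~ X z) \/ overring X.
have [|X [[X0|ovX] maxX]] := @classical_sets.Zorn_bigcup E P.
- move=> C CP totC.
  have [[X0 CX0 ovX0]|noX] := pselect (exists2 X, C X & overring X); last first.
    left=> z [X CX Xz]; case: (CP _ CX) => [|ovX]; first by move/(_ z).
    by apply: noX; exists X.
  have two x y (Y Z : classical_sets.set E) : C Y -> C Z -> Y x -> Z y ->
      exists2 X, C X & [/\ overring X, X x & X y].
    move=> CY CZ Yx Zy; have ov X z : C X -> X z -> overring X.
      by move=> CX Xz; case: (CP _ CX) => // /(_ z).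
    case: (totC _ _ CY CZ) => sub.
      by exists Z => //; split=> //; [apply: ov CZ Zy | apply: sub].
    by exists Y => //; split=> //; [apply: ov CY Yx | apply: sub].
  right; split.
  - by move=> x Ox; exists X0 => //; apply: overring_img ovX0 _ Ox.
  - move=> x y [Y CY Yx] [Z CZ Zy]; have [X CX [ovX Xx Xy]] := two _ _ _ _ CY CZ Yx Zy.
    by exists X => //; apply: overringB.
  - move=> x y [Y CY Yx] [Z CZ Zy]; have [X CX [ovX Xx Xy]] := two _ _ _ _ CY CZ Yx Zy.
    by exists X => //; apply: overringM.
  move=> x [Y CY Yx]; case: (CP _ CY) => [|ovY]; first by move/(_ (iota x)).
  exact: overring_contr ovY _ Yx.
- have [] := maxX A0; last by right.
  split; first by move=> z /X0.
  by move=> /(_ _ (overring_img ovA0 (vr1 O))) /X0.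
exists X => // B ovB sXB z Bz; apply: contrapT => nXz.
have [] := maxX B; last by right.
by split=> // /(_ _ Bz).
Qed.

(** Chevalley's theorem: if a maximal overring A contained neither x nor x^-1,
    both A[x] and A[x^-1] would have too large a trace on K, and relations of
    least degree witnessing this could be shortened. *)
Theorem valring_extension : exists O' : valring E, forall x, O' (iota x) = O x.
Proof.
have [A ovA maxA] := maximal_overring.
have A1 : `[< A 1 >].
  by apply/asboolP; rewrite -(rmorph1 iota); apply/(overring_img ovA)/vr1.
have AB x y : `[< A x >] -> `[< A y >] -> `[< A (x - y) >].
  by move=> /asboolP Ax /asboolP Ay; apply/asboolP/(overringB ovA).
have AM x y : `[< A x >] -> `[< A y >] -> `[< A (x * y) >].
  by move=> /asboolP Ax /asboolP Ay; apply/asboolP/(overringM ovA).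
have AV x : `[< A x >] || `[< A x^-1 >].
  by apply/orP; case: (maximal_overring_inv ovA maxA x) => ?; [left|right]; apply/asboolP.
exists (Valring (vr_mem := fun x => `[< A x >]) A1 AB AM AV) => x /=.
by apply/asboolP/idP => [/(overring_contr ovA)|/(overring_img ovA)].
Qed.

End Chevalley.

(** * Splitting fields *)

Lemma eqp_scale (F : fieldType) (p q : {poly F}) : p %= q ->
  exists2 c, c != 0 & p = c *: q.
Proof.
move/eqpP => [[c1 c2] /= /andP[c10 c20] E12]; exists (c1^-1 * c2).
  by rewrite mulf_neq0 ?invr_eq0.
by rewrite -scalerA -E12 scalerA mulVf // scale1r.
Qed.

Lemma irreducible_factor (F : fieldType) (p : {poly F}) : (1 < size p)%N ->
  exists2 r, r %| p & irreducible_poly r.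
Proof.
have [n] := ubnP (size p); elim: n p => // n IHn p; rewrite ltnS => lepn p_gt1.
have [irr|] := pselect (irreducible_poly p); first by exists p.
move=> nirr; have [q [szq q_dv nqp]] : exists q : {poly F},
    [/\ size q != 1, q %| p & ~~ (q %= p)].
  apply: contrapT => noq; apply: nirr; split=> // q szq q_dv.
  by apply: contrapT => /negP nqp; apply: noq; exists q.
have p0 : p != 0 by rewrite -size_poly_gt0 ltnW.
have lqp : (size q < size p)%N.
  by rewrite ltn_neqAle dvdp_leq // andbT dvdp_size_eqp.
have q_gt1 : (1 < size q)%N.
  by rewrite ltn_neqAle eq_sym szq size_poly_gt0 (dvdpN0 q_dv).
have [r r_dv irr] := IHn q (leq_trans lqp lepn) q_gt1.
by exists r => //; apply: dvdp_trans q_dv.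
Qed.

Definition splits (F : fieldType) (L : fieldExtType F) (p : {poly F}) (rs : seq L) :=
  map_poly (in_alg L) p %= \prod_(z <- rs) ('X - z%:P).

Lemma splits_ext (F : fieldType) (p : {poly F}) : p != 0 ->
  exists (L : fieldExtType F) (rs : seq L), splits p rs.
Proof.
have [n] := ubnP (size p); elim: n => // n IHn in F p * => lepn p0.
have [p_le1|p_gt1] := leqP (size p) 1.
  exists F^o, [::]; rewrite /splits big_nil -size_poly_eq1 size_map_poly.
  by rewrite eqn_leq p_le1 size_poly_gt0.
have [r r_dv irr] := irreducible_factor p_gt1.
have [K _ [x rx0 _]] := irredp_FAdjoin irr.
have [q Dp] : exists q, map_poly (in_alg K) p = q * ('X - x%:P).
  by apply/factor_theorem; rewrite -(divpK r_dv) rmorphM rootM rx0 orbT.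
have q0 : q != 0.
  have : map_poly (in_alg K) p != 0 by rewrite map_poly_eq0.
  by rewrite Dp mulf_eq0 => /norP[].
have szq : (size q < n)%N.
  move: lepn; rewrite -(size_map_poly (in_alg K) p) Dp size_mul ?polyXsubC_eq0 //.
  by rewrite size_XsubC addn2.
have [L [rs Dq]] := IHn K q szq q0.
exists (baseFieldType L), (x%:A :: rs).
rewrite /splits (eq_map_poly (fun a : F => baseField_scaleE a 1)).
rewrite (map_poly_comp (in_alg L) (in_alg K)) Dp rmorphM /= big_cons mulrC.
by rewrite rmorphB /= map_polyX map_polyC /= eqp_mull.
Qed.

(** The roots generate a subfield of the extension built above, which is the
    one required for Galois theory. *)
Lemma splitting_field (F : fieldType) (p : {poly F}) : p != 0 ->
  exists (L : splittingFieldType F) (rs : seq L),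
    splits p rs /\ <<1 & rs>>%VS = {:L}%VS.
Proof.
move=> p0; have [L [ys Dp]] := splits_ext p0.
pose Lp := subvs_of <<1 & ys>>; pose toL := linfun (vsval : Lp -> L).
have [zs Dys] : exists zs, map toL zs = ys.
  exists (map (vsproj _) ys); rewrite -map_comp map_id_in // => y ys_y.
  by rewrite /= lfunE /= vsprojK ?seqv_sub_adjoin.
have Dz : splits (p : {poly F}) (zs : seq Lp).
  rewrite /splits -(eqp_map toL).
  rewrite -map_poly_comp (eq_map_poly (fun x : F => rmorph_alg toL x)).
  have E : map_poly toL (\prod_(z <- zs) ('X - z%:P))
      = \prod_(y <- map toL zs) ('X - y%:P).
    rewrite big_map rmorph_prod; apply: eq_bigr => z _.
    by rewrite rmorphB /= map_polyX map_polyC.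
  by rewrite E Dys.
have Gz : <<1 & zs>>%VS = {:Lp}%VS.
  apply/vspaceP => u; rewrite memvf.
  have: val u \in (toL @: <<1 & zs>>)%VS by rewrite aimg_adjoin_seq aimg1 Dys (valP u).
  by case/memv_imgP=> w Lw; rewrite lfunE => /val_inj->.
have ax : SplittingField.axiom (Lp : fieldExtType F).
  exists (map_poly (in_alg Lp) p); last by exists zs.
  by apply/polyOverP => i; rewrite coef_map /= rpredZ // mem1v.
pose LpS : splittingFieldType F := HB.pack (Lp : fieldExtType F)
  (FieldExt_isSplittingField.Build F Lp ax).
by exists LpS, zs.
Qed.

(** * Immediate algebraic extensions and the values of polynomials *)

Definition attains_max (F : fieldType) (O : valring F) (P : {poly F}) : Prop :=
  exists a0, forall a, wle O P.[a] P.[a0].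

Definition best_approx (F E : fieldType) (iota : {rmorphism F -> E})
    (O' : valring E) (z : E) : Prop :=
  exists a0, forall a, wle O' (z - iota a) (z - iota a0).

Section Approximation.
Variables (F E : fieldType) (iota : {rmorphism F -> E}).
Variables (O : valring F) (O' : valring E).
Hypothesis ext : forall x, O' (iota x) = O x.

Lemma not_best_approx z : ~ best_approx iota O' z ->
  forall a, exists a', wlt O' (z - iota a) (z - iota a').
Proof.
move=> nbest a; apply: contrapT => nlt; apply: nbest; exists a => a'.
by apply: contrapT => /negP nle; apply: nlt; exists a'.
Qed.

(** For every a, the best approximation of a root nearest to a is at least as
    near as a to each root; so the best approximations of the roots are enough
    to find the maximum. *)
Lemma best_approx_attains_max (P : {poly F}) (c : E) (rs : seq E) :
  map_poly iota P = c *: \prod_(t <- rs) ('X - t%:P) ->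
  {in rs, forall t, best_approx iota O' t} -> attains_max O P.
Proof.
move=> DP best.
have DPa a : iota P.[a] = c * \prod_(t <- rs) (iota a - t).
  rewrite -horner_map DP hornerZ horner_prod; congr (_ * _).
  by apply: eq_bigr => t _; rewrite hornerXsubC.
have [s bs] : exists s : seq F, {in rs, forall t,
    exists2 c, c \in s & forall a, wle O' (t - iota a) (t - iota c)}.
  elim: rs best {DP DPa} => [|t rs IHrs] best; first by exists [::].
  have [a0 ma0] := best t (mem_head _ _).
  have [|s bs] := IHrs; first by move=> u rsu; apply: best; rewrite inE rsu orbT.
  exists (a0 :: s) => u; rewrite inE => /predU1P[->|/bs[b sb mb]].
    by exists a0; rewrite ?mem_head.
  by exists b; rewrite // inE sb orbT.
suff dom a : exists2 b, b \in 0 :: s & wle O P.[a] P.[b].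
  have [b _ mb] := wle_argmax O (fun b => P.[b]) 0 s.
  by exists b => a; have [d sd le] := dom a; apply: wle_trans le (mb d sd).
case: rs DP best bs DPa => [|t0 rs] DP best bs DPa.
  exists 0; rewrite ?mem_head // -(wle_map ext) !DPa !big_nil.
  exact: wlexx.
have [t rst maxt] := wle_argmax O' (fun t => iota a - t) t0 rs.
have [b sb mb] := bs t rst; exists b; first by rewrite inE sb orbT.
rewrite -(wle_map ext) !DPa; apply: wleM; first exact: wlexx.
apply: wle_prod => u rsu; apply: (wle_tri (iota a)); last exact: wlexx.
apply: wle_trans (maxt u rsu) _; apply: (wle_tri t).
  by rewrite wBCle wleBC.
by rewrite wleBC wlexx.
Qed.

(** If z were as near to t as to all of F, then an element of F nearer to z than
    the best approximation of t would also be nearer to t. *)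
Lemma best_approx_separated z t : ~ best_approx iota O' z ->
  best_approx iota O' t -> exists a, wlt O' (z - t) (z - iota a).
Proof.
move=> /not_best_approx bad [a ma]; apply: contrapT => none.
have far b : wle O' (z - iota b) (z - t).
  by apply: contrapT => /negP lt; apply: none; exists b.
have [b lt_ab] := bad a; case/negP: (lt_ab).
have le_bt : wle O' (z - iota b) (t - iota b).
  by apply: (wle_tri z); [rewrite wleBC | apply: wlexx].
apply: wle_trans le_bt (wle_trans _ (ma b) _).
have -> : t - iota a = (z - iota a) + (t - z) by rewrite [RHS]addrC addrA subrK.
apply: wle_addl.
by apply: wlt_le_trans lt_ab _; rewrite wleBC.
Qed.

Lemma wlt_prod_near (I : eqType) (s : seq I) (f g : I -> E) :
  {in s, forall i, wlt O' (f i) (f i - g i)} ->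
  wlt O' (\prod_(i <- s) f i) (\prod_(i <- s) f i - \prod_(i <- s) g i).
Proof.
elim: s => [|i s IHs] near; first by rewrite !big_nil subrr wltx0 oner_eq0.
rewrite !big_cons; set p := \prod_(j <- s) f j in IHs *.
set q := \prod_(j <- s) g j in IHs *.
have lpq : wlt O' p (p - q) by apply: IHs => j sj; apply: near; rewrite inE sj orbT.
have lfg := near i (mem_head _ _).
apply: (wlt_tri (f i * q)).
  rewrite -mulrBr !(mulrC (f i)); apply: wltM => //; last exact: wlexx.
  exact: wlt_neq0 lfg.
rewrite -mulrBl; apply: wltM => //; first exact: wlt_neq0 lpq.
by have [] := wle_sub_lt lpq.
Qed.

End Approximation.

(** If no root of g is badly approximable, then each factor z - t of g(z)
    dominates its change when z is replaced by a sufficiently near a. *)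
Lemma horner_approx (F E : fieldType) (iota : {rmorphism F -> E})
    (O' : valring E) (z : E) (g : {poly F}) :
  g != 0 -> ~ best_approx iota O' z ->
  (forall (L : fieldType) (j : {rmorphism E -> L}) (O'' : valring L) (t : L),
     (forall x, O'' (j x) = O' x) -> root (map_poly (j \o iota) g) t ->
     best_approx (j \o iota) O'' t) ->
  exists a, wlt O' (map_poly iota g).[z] ((map_poly iota g).[z] - iota g.[a]).
Proof.
move=> g0 bad good.
have gi0 : map_poly iota g != 0 by rewrite map_poly_eq0.
have [L [rs Dg]] := splits_ext gi0.
pose j := in_alg L : {rmorphism E -> L}.
have [O'' extj] := valring_extension j O'.
have {}Dg : map_poly (j \o iota) g %= \prod_(t <- rs) ('X - t%:P).
  by rewrite map_poly_comp.
have [c c0 Eg] := eqp_scale Dg.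
have badj : ~ best_approx (j \o iota) O'' (j z).
  case=> a ma; apply: bad; exists a => b.
  by have := ma b; rewrite -!rmorphB (wle_map extj).
have [a na] : exists a, {in rs, forall t, wlt O'' (j z - t) (j z - j (iota a))}.
  have : {in rs, forall t, best_approx (j \o iota) O'' t}.
    by move=> t rst; apply: good => //; rewrite (eqp_root Dg) root_prod_XsubC.
  elim: (rs) => [|t s IHs] best; first by exists 0.
  have [|a na] := IHs; first by move=> u su; apply: best; rewrite inE su orbT.
  have [b nb] := best_approx_separated badj (best t (mem_head _ _)).
  case/orP: (wle_total O'' (j z - j (iota a)) (j z - j (iota b))) => l.
    by exists b => u; rewrite inE => /predU1P[->//|/na lu]; apply: wlt_le_trans lu l.
  by exists a => u; rewrite inE => /predU1P[->|/na//]; apply: wlt_le_trans nb l.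
exists a; rewrite /wlt -(wle_map extj) rmorphB -!horner_map -!map_poly_comp /= Eg.
rewrite -/(wlt _ _ _) !hornerZ -mulrBr !horner_prod !(mulrC c).
apply: wltM => //; last exact: wlexx.
apply: wlt_prod_near => t rst; rewrite !hornerXsubC opprB subrKA.
exact: na.
Qed.

(** Every y is asymptotic to some a in F, and v(a) depends only on y: this is
    the value of y. *)
Lemma immediate_valuation (F L : fieldType) (e : {rmorphism F -> L})
    (G : orderedZmodType) (v : valuation F G) (OL : valring L) :
  (forall x, OL (e x) = in_valuation_ring v x) ->
  (forall y, y != 0 -> exists a, wlt OL y (y - e a)) ->
  exists2 w : valuation L G, forall x y, wle OL x y = (w x <= w y) &
    forall x, w (e x) = v x.
Proof.
move=> ext imm; have extw := wle_map (O := valring_of v) ext.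
have /choice[a ae] y : exists b, wle OL y (e b) /\ wle OL (e b) y.
  have [->|y0] := eqVneq y 0; first by exists 0; rewrite rmorph0 wlexx.
  by have [b /wle_sub_lt] := imm y y0; exists b.
pose w y := v (a y).
have Ew x y : wle OL x y = (w x <= w y).
  rewrite /w -wle_valring_of -extw; have [[x1 x2] [y1 y2]] := (ae x, ae y).
  apply/idP/idP => le; first exact: wle_trans x2 (wle_trans _ le y1).
  exact: wle_trans x1 (wle_trans _ le y2).
have weq x y : wle OL x y -> wle OL y x -> w x = w y.
  by rewrite !Ew => xy yx; apply/le_anti/andP.
have we x : w (e x) = v x.
  apply/le_anti; rewrite -!wle_valring_of -!extw.
  by have [-> ->] := ae (e x).
have wsurj g : exists x, w x = g.
  by have [x Dx] := valuation_surj v g; exists (e x); rewrite we.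
have wtop x : w x = \top%O <-> x = 0.
  split=> [/valuation_eq_top ax|->]; last by rewrite -(rmorph0 e) we valuation0.
  by have [_] := ae x; rewrite ax rmorph0 wle0x => /eqP.
have wM x y : w (x * y) = w x + w y.
  rewrite -[RHS]valuationM -we; have [[x1 x2] [y1 y2]] := (ae x, ae y).
  by apply: weq; rewrite rmorphM; apply: wleM.
have wD x y : Order.min (w x) (w y) <= w (x + y).
  by case: (leP (w x) (w y)) => [|/ltW]; rewrite -!Ew => l; apply: wleD => //;
     apply: wlexx.
by exists (Valuation wsurj wtop wM wD).
Qed.

Section AlgebraicallyMaximal.
Variables (F : fieldType) (G : orderedZmodType) (v : valuation F G).

Definition badly_approximable_root (n : nat) : Prop :=
  exists (E : fieldType) (iota : {rmorphism F -> E}) (O' : valring E) (z : E)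
      (f : {poly F}),
    [/\ forall x, O' (iota x) = in_valuation_ring v x, f != 0, size f = n,
        root (map_poly iota f) z & ~ best_approx iota O' z].

Lemma max_or_bad (P : {poly F}) : attains_max (valring_of v) P \/
  exists n, badly_approximable_root n.
Proof.
have [->|P0] := eqVneq P 0.
  by left; exists 0 => a; rewrite !horner0 wlexx.
have [L [rs DP]] := splits_ext P0.
have [O' ext] := valring_extension (in_alg L) (valring_of v).
have [allbest|] := pselect {in rs, forall t, best_approx (in_alg L) O' t}.
  have [c _ EP] := eqp_scale DP.
  by left; apply: (best_approx_attains_max ext EP allbest).
move=> nall; right.
have [t rst bad] : exists2 t, t \in rs & ~ best_approx (in_alg L) O' t.
  apply: contrapT => none; apply: nall => t rst; apply: contrapT => bad.
  by apply: none; exists t.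
exists (size P), L, (in_alg L), O', t, P; split=> //.
by rewrite (eqp_root DP) root_prod_XsubC.
Qed.

(** A badly approximable root z of least degree generates a proper immediate
    extension: the elements of F(z) are values at z of polynomials of lower
    degree, which have no badly approximable root. *)
Lemma algebraically_maximal_attains_max : algebraically_maximal v ->
  forall P, attains_max (valring_of v) P.
Proof.
move=> maxv P; have [//|exbad] := max_or_bad P; exfalso.
pose bad n := `[< badly_approximable_root n >].
have exb : exists n, bad n by case: exbad => n bn; exists n; apply/asboolP.
case: (ex_minnP exb) => n /asboolP[E [iota [O' [z [f [ext f0 szf fz badz]]]]]] minn.
have goodpoly (g : {poly F}) : g != 0 -> (size g < n)%N ->
    exists a, wlt O' (map_poly iota g).[z] ((map_poly iota g).[z] - iota g.[a]).
  move=> g0 ltg; apply: horner_approx => // L j O'' t extj rt.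
  apply: contrapT => badt; have badg : bad (size g).
    by apply/asboolP; exists L, (j \o iota), O'', t, g; split=> // x; rewrite extj ext.
  by have := minn _ badg; rewrite leqNgt ltg.
pose Fz := subFExtend iota z f; pose j := @subfx_inj _ _ iota z f : {rmorphism Fz -> E}.
pose e := @inj_subfx _ _ iota z f : {rmorphism F -> Fz}.
have je x : j (e x) = iota x.
  by rewrite [LHS]subfx_inj_eval // map_polyC hornerC.
have jV x : O' (j x) || O' (j x^-1) by rewrite fmorphV vrV.
have j1 : O' (j 1) by rewrite rmorph1 vr1.
have jB x y : O' (j x) -> O' (j y) -> O' (j (x - y)) by rewrite rmorphB; apply: vrB.
have jM x y : O' (j x) -> O' (j y) -> O' (j (x * y)) by rewrite rmorphM; apply: vrM.
pose OL : valring Fz := Valring (vr_mem := fun x => O' (j x)) j1 jB jM jV.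
have wj x y : wle O' (j x) (j y) = wle OL x y by apply: wle_map.
have extL x : OL (e x) = in_valuation_ring v x by rewrite -ext -je.
have imm y : y != 0 -> exists a, wlt OL y (y - e a).
  have [g Dy] := subfxE y; move=> y0.
  have jy : j y = (map_poly iota (g %% f)).[z].
    rewrite Dy [LHS]subfx_inj_eval // {1}(divp_eq g f) rmorphD rmorphM /=.
    by rewrite hornerD hornerM (rootP fz) mulr0 add0r.
  have gf0 : g %% f != 0.
    by apply: contraNneq y0 => gf0; rewrite -(fmorph_eq0 j) jy gf0 rmorph0 horner0.
  have [|a na] := goodpoly _ gf0; first by rewrite -szf ltn_modp.
  by exists (g %% f).[a]; rewrite /wlt -wj rmorphB jy /= je.
have [w wle_w we] := immediate_valuation extL imm.
have embv x : w (e x) = (omap (idfun : {additive G -> G}) (v x) : extended G).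
  by rewrite we; case: (v x).
pose ve : vfield_extension v w := VfieldExtension (vfield_emb := e)
   (vgroup_emb := idfun : {additive G -> G}) (fun _ _ => erefl) embv.
have alg : algebraic_vfield ve.
  move=> y; have [g ->] := subfxEroot fz f0 y.
  apply/integral_algebraic/integral_horner.
    apply/integral_poly => i; rewrite coef_map /=.
    by rewrite -[_%:A]/(e _ * 1) mulr1; apply: integral_id.
  apply/integral_algebraic; exists f => //.
  rewrite rootE -(fmorph_eq0 j) -horner_map -map_poly_comp.
  rewrite (eq_map_poly (je : j \o ve =1 iota)).
  by rewrite [j _]subfx_inj_root.
have immv : immediate_vfield ve.
  split=> [h|y]; first by exists h.
  have [->|y0] := eqVneq y 0.
    exists 0; first by rewrite /in_valuation_ring valuation0 lex1.
    by rewrite /in_valuation_ideal rmorph0 subr0 valuation0 lt_neqAle lex1 andbT.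
  have [a na] := imm y y0; rewrite /in_valuation_ring => wy; exists a.
    have [ya _] := wle_sub_lt na; rewrite -we; apply: le_trans wy _.
    by rewrite -wle_w.
  rewrite /in_valuation_ideal; apply: le_lt_trans wy _.
  by rewrite ltNge -wle_w.
have [x Dx] := maxv Fz G w ve alg immv (@subfx_root _ _ iota z f).
apply: badz; exists x => a.
rewrite -(je x) -[e x]/(ve x) Dx [j _]subfx_inj_root // subrr.
exact: wlex0.
Qed.

End AlgebraicallyMaximal.

(** * Uniqueness of the extended valuation ring over a henselian field *)

Section Separation.
Variables (E : fieldType) (O : valring E).
Implicit Types x y : E.

Lemma wle_unit x y : wle O 1 x -> wle O x 1 -> wle O 1 y -> wle O y 1 ->
  wle O 1 (x * y) /\ wle O (x * y) 1.
Proof. by move=> *; split; rewrite -{1}[1]mulr1; apply: wleM. Qed.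

(** Sylvester's recursion makes the successive 1 + y pairwise coprime: a residue
    is a zero of at most one of them.  This yields, for finitely many residues
    at once, a denominator 1 + y in y / (1 + y) that is nowhere zero. *)
Definition sylvester (y : E) : E := y * (1 + y).

Lemma sylvester_big j x : wlt O x 1 -> wlt O (iter j sylvester x) 1.
Proof.
move=> xlt; elim: j => //= j; set y := iter j _ _ => ylt.
apply: (wle_lt_trans _ _ ylt); rewrite /sylvester -[X in wle _ _ X]mulr1.
apply: wleM; first exact: wlexx.
by rewrite addrC; apply: wle_trans (wle_addl ylt) (wltW ylt).
Qed.

Lemma sylvester_small j x : wlt O 1 x -> wlt O 1 (iter j sylvester x).
Proof.
move=> xlt; elim: j => //= j; set y := iter j _ _ => ylt.
rewrite /sylvester -[X in wlt _ X _]mulr1; apply: wltM; rewrite ?oner_neq0 //.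
by apply: wleD; [apply: wlexx | apply: wltW].
Qed.

Definition sylvester_bad j x := wlt O 1 (1 + iter j sylvester x).

(** Once 1 + y is small, all later iterates are small. *)
Lemma sylvester_bad_uniq j k x : (j < k)%N -> sylvester_bad j x -> ~~ sylvester_bad k x.
Proof.
move=> /subnK <-; move: (k - j.+1)%N => m {k}.
rewrite /sylvester_bad addnS -addSn iterD => bad.
set y := iter j sylvester x in bad *.
have small : wlt O 1 (iter m.+1 sylvester y).
  rewrite -addn1 iterD; apply: sylvester_small; rewrite /= /sylvester mulrC.
  rewrite -[X in wlt _ X _]mulr1; apply: wltM; rewrite ?oner_neq0 //.
  rewrite -[y](addKr 1); apply: wleD; last exact: wltW.
  by rewrite wleN wlexx.
by rewrite negbK; apply: wle_addl.
Qed.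

Lemma sylvester_ratio_in j x : ~~ sylvester_bad j x ->
  O (iter j sylvester x / (1 + iter j sylvester x)).
Proof.
rewrite /sylvester_bad /wlt negbK => le1; set y := iter j sylvester x in le1 *.
have y10 : 1 + y != 0.
  by apply: contraTneq le1 => ->; rewrite wle0x oner_eq0.
rewrite -wle1 -(wle_pM2r _ _ _ y10) mul1r divfK //.
rewrite -[X in wle _ _ X](addKr 1); apply: wleD; last exact: wlexx.
by rewrite wleN.
Qed.

Lemma sylvester_ratio_unit j x : wlt O x 1 ->
  let z := iter j sylvester x / (1 + iter j sylvester x) in
  wle O 1 z /\ wle O z 1.
Proof.
move=> /(sylvester_big j); set y := iter j _ _ => ylt /=.
have y0 := wlt_neq0 ylt.
have le1 : wle O (1 + y) y by rewrite addrC; apply: wle_addl.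
have le2 : wle O y (1 + y) by apply: wleD; [apply: wltW | apply: wlexx].
have y10 : 1 + y != 0 by apply: contraNneq y0 => e; rewrite e wle0x in le1.
by split; rewrite -(wle_pM2r _ _ _ y10) mul1r divfK.
Qed.

Lemma sylvester_ratio_small j x : wlt O 1 x ->
  wlt O 1 (iter j sylvester x / (1 + iter j sylvester x)).
Proof.
move=> /(sylvester_small j); set y := iter j _ _ => ylt /=.
have le1 : wle O (1 + y) 1 by apply: wle_addl.
have y10 : 1 + y != 0 by apply: contraTneq le1 => ->; rewrite wle0x oner_eq0.
by rewrite /wlt -(wle_pM2r _ _ _ y10) mul1r divfK //; apply: wle_lt_trans le1 ylt.
Qed.

End Separation.

Section HenselianGalois.
Variables (F : fieldType) (G : orderedZmodType) (v : valuation F G).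
Variables (L : splittingFieldType F) (O : valring L).
Hypothesis ext : forall a, O (a%:A) = in_valuation_ring v a.
Local Notation Gal := (gal_of {:L}).
Implicit Types (s t d : Gal) (x y z : L).

Lemma galM_full s t x : (s * t)%g x = t (s x).
Proof. by rewrite galM ?memvf. Qed.

Lemma galK_full s x : s^-1%g (s x) = x.
Proof. by rewrite -galM_full mulgV gal_id. Qed.

Lemma galKV_full s x : s (s^-1%g x) = x.
Proof. by rewrite -galM_full mulVg gal_id. Qed.

Lemma gal_in_alg s a : s (a%:A) = a%:A.
Proof. by rewrite linearZ /= rmorph1. Qed.

Lemma gal_iter_sylvester s j x :
  s (iter j (@sylvester L) x) = iter j (@sylvester L) (s x).
Proof.
elim: j => //= j IHj; rewrite /sylvester rmorphM rmorphD rmorph1 /=.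
by rewrite IHj.
Qed.

(** The decomposition group of O: an inclusion between O and a conjugate is an
    equality since the Galois group is finite. *)
Definition decomp : {set Gal} := [set s : Gal | `[< forall x, O x -> O (s x) >]].

Lemma decompP s : reflect (forall x, O x -> O (s x)) (s \in decomp).
Proof. by rewrite inE; apply: asboolP. Qed.

Lemma decomp_group_set : group_set decomp.
Proof.
apply/group_setP; split; first by apply/decompP => x; rewrite gal_id.
move=> s t /decompP Ds /decompP Dt; apply/decompP => x Ox.
by rewrite galM_full; apply/Dt/Ds.
Qed.
Canonical decomp_group := Group decomp_group_set.

Lemma decomp_wle d x y : d \in decomp -> wle O (d x) (d y) = wle O x y.
Proof.
have half t x' y' : t \in decomp -> wle O x' y' -> wle O (t x') (t y').
  move=> /decompP Dt; rewrite /wle !fmorph_eq0 -fmorph_div /= => /orP[->//|].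
  by case/andP => -> /Dt ->; rewrite orbT.
move=> Dd; apply/idP/idP; last exact: half.
by move/(half d^-1%g); rewrite !galK_full groupV; apply.
Qed.

(** Neither O nor its conjugate by s contains the other, because [decomp] is
    closed under inversion; a quotient of the two witnesses is u. *)
Lemma conjugate_incomparable s : s \notin decomp ->
  exists2 u, wlt O u 1 & wlt O 1 (s u).
Proof.
move=> nDs; have nDsV : s^-1%g \notin decomp by rewrite groupV.
have nsub t : t \notin decomp -> exists2 x, O x & ~~ O (t x).
  move=> nDt; apply: contrapT => none; case/decompP: nDt => x Ox.
  by apply: contrapT => /negP nOtx; apply: none; exists x.
have [a Oa nOsa] := nsub s nDs; have [c Oc nOsc] := nsub _ nDsV.
have sa0 : s a != 0 by apply: contraNneq nOsa => ->; apply: vr0.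
have a0 : a != 0 by rewrite -(fmorph_eq0 s).
exists (s^-1%g c / a).
  rewrite /wlt -(wle_pM2r _ _ _ a0) mul1r divfK //; apply: contra nOsc => l.
  by rewrite -wle1; apply: wle_trans l; rewrite wle1.
rewrite fmorph_div /= galKV_full /wlt -(wle_pM2r _ _ _ sa0) mul1r divfK //.
by apply: contra nOsa => l; rewrite -wle1; apply: wle_trans l; rewrite wle1.
Qed.

(** Apply y / (1 + y) to u, where u is large and s u small: the result is a unit,
    and its image by s is small.  At most one of the iterates of u is bad for a
    given conjugate, so one of the first |Gal| + 1 is good for all of them. *)
Lemma separate_conjugate s : s \notin decomp ->
  exists z, [/\ wle O 1 z, wle O z 1, wlt O 1 (s z) & forall t, O (t z)].
Proof.
move=> /conjugate_incomparable[u ult slt].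
have [j good] : exists j, forall t : Gal, ~~ sylvester_bad O j (t u).
  apply: contrapT => none.
  have bad (j : 'I_#|{: Gal}|.+1) : exists t : Gal, sylvester_bad O j (t u).
    apply: contrapT => nbad; apply: none; exists j => t; apply/negP => b.
    by apply: nbad; exists t.
  have [f fP] := choice bad.
  have finj : injective f.
    move=> j k; case: (ltngtP j k) => [lt|lt|/val_inj//] fjk.
      by have := sylvester_bad_uniq lt (fP j); rewrite fjk fP.
    by have := sylvester_bad_uniq lt (fP k); rewrite -fjk fP.
  by have := leq_card f finj; rewrite card_ord ltnn.
exists (iter j (@sylvester L) u / (1 + iter j (@sylvester L) u)).
have [z1 z2] := sylvester_ratio_unit j ult.
have tE t : t (iter j (@sylvester L) u / (1 + iter j (@sylvester L) u))
    = iter j (@sylvester L) (t u) / (1 + iter j (@sylvester L) (t u)).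
  by rewrite fmorph_div rmorphD rmorph1 /= gal_iter_sylvester.
split=> // [|t]; rewrite tE; first exact: sylvester_ratio_small.
exact: sylvester_ratio_in.
Qed.

(** The product of the elements found for the various s is small at every s
    outside the decomposition group; its norm to the decomposition field is
    moreover invariant. *)
Lemma separate_decomp : exists y, [/\ wle O 1 y, wle O y 1,
  forall d, d \in decomp -> d y = y & forall s, s \notin decomp -> wlt O 1 (s y)].
Proof.
have /choice[zf zfP] s : exists z, [/\ wle O 1 z, wle O z 1, forall t, O (t z)
    & s \notin decomp -> wlt O 1 (s z)].
  have [Ds|nDs] := boolP (s \in decomp).
    by exists 1; rewrite wlexx; split=> // t; rewrite rmorph1 vr1.
  by have [z [z1 z2 z3 z4]] := separate_conjugate nDs; exists z.
pose z := \prod_s zf s.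
have z1 : wle O 1 z /\ wle O z 1.
  apply: (big_rec (fun x => wle O 1 x /\ wle O x 1)) => [|s x _ [x1 x2]].
    by rewrite wlexx.
  by have [? ? _ _] := zfP s; apply: wle_unit.
have Oz t : O (t z).
  rewrite rmorph_prod.
  apply: (big_ind (fun x => O x)) => [|x y|s _]; [exact: vr1 | exact: vrM |].
  by have [_ _ + _] := zfP s; apply.
have sz s : s \notin decomp -> wlt O 1 (s z).
  move=> nDs; rewrite rmorph_prod (bigD1 s) //= -[X in wlt _ X _]mulr1.
  apply: wltM; rewrite ?oner_neq0 //; first by have [_ _ _] := zfP s; apply.
  rewrite wle1.
  apply: (big_ind (fun x => O x)) => [|x y|t _]; [exact: vr1 | exact: vrM |].
  by have [_ _ + _] := zfP t; apply.
exists (\prod_(d in decomp) d z).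
have [y1 y2] : wle O 1 (\prod_(d in decomp) d z) /\ wle O (\prod_(d in decomp) d z) 1.
  apply: (big_rec (fun x => wle O 1 x /\ wle O x 1)) => [|d x Dd [x1 x2]].
    by rewrite wlexx.
  by apply: wle_unit; rewrite // -(rmorph1 d) decomp_wle //; case: z1.
split=> // [d Dd|s nDs].
  rewrite rmorph_prod [RHS](reindex_inj (mulIg d)) /=; apply: eq_big => t.
    by rewrite groupMr.
  by rewrite galM_full.
rewrite rmorph_prod (bigD1 1%g) ?group1 //= gal_id -[X in wlt _ X _]mulr1.
apply: wltM; rewrite ?oner_neq0 //; first exact: sz.
rewrite wle1.
apply: (big_ind (fun x => O x)) => [|x y|t _]; [exact: vr1 | exact: vrM |].
by rewrite -galM_full.
Qed.

Hypotheses (hensv : henselian v) (galL : galois 1 {:L}).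

Lemma coef_prod_XsubC_in (rs : seq L) : {in rs, forall b, O b} ->
  forall i, O (\prod_(b <- rs) ('X - b%:P))`_i.
Proof.
elim: rs => [|b rs IHrs] Orb i.
  by rewrite big_nil coef1; case: (i == 0); [apply: vr1 | apply: vr0].
rewrite big_cons mulrBl coefB coefXM mul_polyC coefZ.
have Op k : O (\prod_(j <- rs) ('X - j%:P))`_k.
  by apply: IHrs => c rc; apply: Orb; rewrite inE rc orbT.
apply: vrB; first by case: (i == 0); [apply: vr0 | apply: Op].
by apply: vrM => //; apply: Orb; rewrite mem_head.
Qed.

Lemma horner_in (p : {poly L}) x : (forall i, O p`_i) -> O x -> O p.[x].
Proof.
move=> Op Ox; rewrite horner_coef; apply: (big_ind (fun x => O x)) => [|y z|i _].
- exact: vr0.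
- exact: vrD.
by apply: vrM => //; elim: (i : nat) => [|n IHn]; rewrite ?expr0 ?vr1 // exprS vrM.
Qed.

(** The conjugates of the separating element y other than y are small, so its
    minimal polynomial has a simple zero in the residue field, namely the class
    of the trace of y.  The root in F that lifts it is conjugate to y, so y is
    in F and has no conjugate other than itself: there is nothing to separate. *)
Theorem henselian_gal_valring s x : O (s x) = O x.
Proof.
suff Ds t : t \in decomp by rewrite -!wle1 -{1}(rmorph1 s) decomp_wle.
apply: contrapT => /negP nDt.
have [y [y1 y2 Dy Ny]] := separate_decomp.
have [r [_ Ur Dmin]] := elimT (galois_factors (sub1v _)) galL y (memvf _).
set ry := map _ r in Ur Dmin.
have yry : y \in ry by rewrite -root_prod_XsubC -Dmin root_minPoly.
have ryP b : b \in ry -> b = y \/ exists2 s, s \notin decomp & b = s y.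
  case/mapP => u _ ->; have [Du|nDu] := boolP (u \in decomp); last by right; exists u.
  by left; apply: Dy.
pose rest := rem y ry.
have restP b : b \in rest -> wlt O 1 b.
  rewrite mem_rem_uniq // inE => /andP[/eqP nby /ryP[//|[u nDu ->]]].
  exact: Ny.
have Oy : O y by rewrite -wle1.
have Orest b : b \in rest -> O b by move=> /restP/wltW; rewrite wle1.
have [f Df] : exists f : {poly F}, minPoly 1 y = map_poly (in_alg L) f.
  by apply/polyOver1P/minPolyOver.
have Ef : map_poly (in_alg L) f = ('X - y%:P) * \prod_(b <- rest) ('X - b%:P).
  by rewrite -Df Dmin (perm_big _ (perm_to_rem yry)) big_cons.
set h := \prod_(b <- rest) _ in Ef.
have Oh i : O h`_i by apply: coef_prod_XsubC_in.
have Of i : in_valuation_ring v f`_i.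
  rewrite -ext -[_%:A]/(in_alg L _) -coef_map Ef.
  rewrite mulrBl coefB coefXM mul_polyC coefZ; apply: vrB; last exact: vrM.
  by case: (i == 0); [apply: vr0 | apply: Oh].
(* The trace of y, congruent to y since the other conjugates are small. *)
pose a := - f`_(size rest).
have Da : a%:A = y + \sum_(b <- rest) b.
  have := @coefPn_prod_XsubC _ (y :: rest) isT; rewrite !big_cons /= -/h -Ef coef_map /=.
  by rewrite /a scaleNr => ->; rewrite opprK.
have near : wlt O 1 (a%:A - y).
  rewrite Da addrAC subrr add0r.
  rewrite big_seq; apply: (big_ind (fun x => wlt O 1 x)) => [|b c|b rb].
  - by rewrite wltx0 oner_neq0.
  - exact: wltD.
  exact: restP.
have Oa : O a%:A by rewrite -[a%:A](subrK y) vrD // -wle1 wltW.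
have a_unit b : b \in rest -> wle O (a%:A - b) 1.
  move=> rb; have small : wlt O 1 (a%:A - y - b).
    by apply: wltD => //; rewrite /wlt wNle; apply: restP.
  have -> : a%:A - b = y + (a%:A - y - b) by rewrite addrA [y + _]addrC subrK.
  by apply: wle_trans (wle_addl (wle_lt_trans _ y2 small)) y2.
have ha : wle O h.[a%:A] 1.
  have := wle_prod (O := O) (f := fun b => a%:A - b) (g := fun=> 1) a_unit.
  rewrite big1_eq horner_prod; under [X in _ -> wle _ X _]eq_bigr do rewrite hornerXsubC.
  by [].
have wext := wle_map (iota := in_alg L) (O := valring_of v) ext.
have in_ideal (x0 : F) : in_valuation_ideal v x0 = wlt O 1 (in_alg L x0).
  by rewrite -(rmorph1 (in_alg L)) /wlt wext -/(wlt _ _ _) wlt_valring_of valuation1.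
have [|||c [fc _]] := hensv Of (a := a).
- by rewrite -ext.
- rewrite in_ideal -horner_map Ef hornerM hornerXsubC -[X in wlt _ X _]mulr1.
  by apply: wltM; rewrite ?oner_neq0 // wle1; apply: horner_in.
- rewrite in_ideal -horner_map -deriv_map Ef derivM derivXsubC mul1r.
  rewrite hornerD hornerM hornerXsubC negbK; apply: (wle_trans _ _ ha).
  apply: wle_addl; apply: (wle_lt_trans _ ha); rewrite -[X in wlt _ X _]mulr1.
  apply: wltM; rewrite ?oner_neq0 // wle1; apply: horner_in => // i.
  rewrite coef_deriv; move: (h`_i.+1) (Oh i.+1) => c Oc.
  elim: i.+1 => [|n IHn]; first by rewrite mulr0n vr0.
  by rewrite mulrS; apply: vrD.
have : in_alg L c \in ry.
  by rewrite -root_prod_XsubC -Dmin Df rootE horner_map /= (rootP fc) scale0r.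
case/mapP => u _ Dc; have Ey : y = c%:A.
  by rewrite -(galK_full u y) -Dc /= gal_in_alg.
by have := Ny t nDt; rewrite Ey gal_in_alg -Ey /wlt y2.
Qed.

End HenselianGalois.

(** * Additive polynomials over extension fields *)

Lemma additive_comp (L : fieldType) (A c : {poly L}) : additive_polynomial A ->
  A \Po (c + 'X) = A \Po c + A.
Proof.
move=> addA; have := congr1 (fun P => P.[c]) addA; rewrite /poly_XaY horner_comp.
by rewrite !hornerE.
Qed.

Lemma additive_polynomial_map (F L : fieldType) (iota : {rmorphism F -> L})
    (Q : {poly F}) :
  additive_polynomial (map_poly iota Q) -> additive_polynomial Q.
Proof.
move=> addQ; apply/polyP => i; apply/polyP => j; apply: (fmorph_inj iota).
rewrite coef_poly_XaY rmorphMn /= -coef_map -coef_poly_XaY addQ !coefD.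
rewrite !(coef_map, coefC) rmorphD /=.
case: (i == 0); rewrite ?coef0 ?(coef_map, coefC) /=.
all: by case: (j == 0); rewrite ?rmorph0.
Qed.

Lemma size_monicB (R : nzRingType) (p q : {poly R}) n :
  p \is monic -> q \is monic -> size p = n.+1 -> size q = n.+1 ->
  (size (p - q)%R <= n)%N.
Proof.
move=> /monicP mp /monicP mq szp szq; apply/leq_sizeP => j lenj.
rewrite coefB; move: lenj; rewrite leq_eqVlt => /predU1P[<-|ltnj].
  by move: mp mq; rewrite /lead_coef szp szq /= => -> ->; rewrite subrr.
by rewrite !nth_default ?subrr ?szp ?szq.
Qed.

Lemma perm_map_stable (T : eqType) (f : T -> T) (s : seq T) :
  injective f -> uniq s -> {in s, forall x, f x \in s} -> perm_eq (map f s) s.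
Proof.
move=> injf Us sf; have Uf : uniq (map f s) by rewrite map_inj_uniq.
have sub : {subset map f s <= s} by move=> _ /mapP[x sx ->]; apply: sf.
by apply: uniq_perm => //; have [] := uniq_min_size Uf sub; rewrite ?size_map.
Qed.

(** A(X + Y) - A(X) - A(Y), as a polynomial in X, has lower degree than A, and
    it vanishes on K because A is invariant under translation by K. *)
Lemma additive_prod_XsubC (L : fieldType) (K : seq L) :
  uniq K -> K != [::] -> {in K &, forall x y, x - y \in K} ->
  additive_polynomial (\prod_(k <- K) ('X - k%:P)).
Proof.
move=> Uk Kn0 Ksub; set A := \prod_(k <- K) _.
have szK : (0 < size K)%N by case: (K) Kn0.
have AK k : k \in K -> A \Po (k%:P + 'X) = A.
  move=> Kk; rewrite /A rmorph_prod.
  have permK : perm_eq [seq k' - k | k' <- K] K.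
    by apply: perm_map_stable => // [|k' Kk']; [apply: addIr | apply: Ksub].
  rewrite -[RHS](perm_big _ permK) big_map; apply: eq_bigr => k' _.
  by rewrite /= comp_polyB comp_polyX comp_polyC polyCB; ring.
have XaY : poly_XaY A = \prod_(k <- K) ('X - (k%:P - 'X)%:P).
  rewrite /poly_XaY /A !rmorph_prod; apply: eq_bigr => k _.
  rewrite /= rmorphB /= map_polyX map_polyC /= comp_polyB comp_polyX comp_polyC.
  by rewrite polyCB; ring.
have szX : size (poly_XaY A) = (size K).+1.
  by rewrite XaY size_prod_XsubC.
have mX : poly_XaY A \is monic.
  by rewrite XaY monic_prod_XsubC.
have szA : size A^:P = (size K).+1.
  by rewrite size_map_polyC size_prod_XsubC.
have mA : A^:P \is monic by rewrite map_monic monic_prod_XsubC.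
apply/eqP; rewrite -subr_eq0; apply/eqP.
apply: (@roots_geq_poly_eq0 _ _ [seq k%:P | k <- K]).
- apply/allP => _ /mapP[k Kk ->].
  have -> : root (poly_XaY A - (A^:P + A%:P)) k%:P
      = (A \Po (k%:P + 'X) - (A \Po k%:P + A) == 0).
    by rewrite rootE /poly_XaY !(hornerE, horner_comp).
  rewrite (AK k Kk) comp_polyCr.
  have /rootP-> : root A k by rewrite root_prod_XsubC.
  by rewrite add0r subrr.
- by rewrite map_inj_uniq //; apply: polyC_inj.
rewrite size_map opprD addrA.
apply: leq_trans (size_polyD _ _) _; rewrite geq_max size_monicB //=.
by rewrite size_polyN; apply: leq_trans (size_polyC_leq1 _) szK.
Qed.

Section AddpolyExtension.
Variables (p : nat) (F L : fieldType) (charFp : p \in [pchar F]).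
Variable iota : {rmorphism F -> L}.
Local Notation R := (skewpoly (pFrobenius_aut charFp)).
Implicit Types r : R.

Let p_pr : prime p. Proof. exact: pcharf_prime charFp. Qed.

Lemma addpoly_mapD r x y : (map_poly iota (addpoly r)).[x + y] =
  (map_poly iota (addpoly r)).[x] + (map_poly iota (addpoly r)).[y].
Proof.
elim/skew_ind: r => [|r s IHr IHs|n a].
- by rewrite addpoly0 rmorph0 !horner0 addr0.
- by rewrite addpolyD rmorphD /= !hornerD IHr IHs addrACA.
rewrite addpoly_mono map_polyZ /= map_polyXn !hornerZ !hornerXn.
rewrite exprDn_pchar ?mulrDr // pnatX pnatE //.
by rewrite (rmorph_pchar iota charFp).
Qed.

Lemma addpoly_mapN r x : (map_poly iota (addpoly r)).[- x] =
  - (map_poly iota (addpoly r)).[x].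
Proof.
have e0 : (map_poly iota (addpoly r)).[0] = 0.
  by apply: (addrI (map_poly iota (addpoly r)).[0]); rewrite -addpoly_mapD !addr0.
by apply/eqP; rewrite -addr_eq0 -addpoly_mapD addNr e0.
Qed.

Lemma coef_addpoly_comp r a c k :
  (addpoly r \Po (a%:P + c *: 'X))`_(p ^ k) = skcoef r k * c ^+ (p ^ k).
Proof.
elim/skew_ind: r => [|r s IHr IHs|n b].
- by rewrite addpoly0 comp_poly0 coef0 /skcoef coef0 mul0r.
- by rewrite addpolyD comp_polyD coefD IHr IHs -mulrDl /skcoef coefD.
rewrite addpoly_mono comp_polyZ comp_Xn_poly exprDn_pchar; last first.
  by rewrite pnatX pnatE // !pchar_poly charFp.
rewrite -rmorphXn /= exprZn coefZ coefD coefC coefZ coefXn.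
have pk0 : (0 < p ^ k)%N by rewrite expn_gt0 prime_gt0.
rewrite (gtn_eqF pk0) add0r eqn_exp2l ?prime_gt1 // skcoef_mono.
by case: eqP => [->|_]; rewrite ?mulr1 // !mulr0 mul0r.
Qed.

Lemma deriv_addpoly r : (addpoly r)^`() = (skcoef r 0)%:P.
Proof.
elim/skew_ind: r => [|r s IHr IHs|n b].
- by rewrite addpoly0 deriv0 /skcoef coef0.
- by rewrite addpolyD derivD IHr IHs -polyCD /skcoef coefD.
rewrite addpoly_mono derivZ derivXn skcoef_mono; case: n => [|n].
  by rewrite expn0 expr0 mulr1n -mul_polyC mulr1.
rewrite expnS -mulr_natr natrM [p%:R](_ : _ = 0); last first.
  by apply/eqP; rewrite -polyC_natr polyC_eq0 (pcharf0 charFp).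
by rewrite mul0r mulr0 scaler0.
Qed.

End AddpolyExtension.

(** * Approximation data carried by an additive polynomial *)

(** The roots - u / c lie outside the unit ball: the Newton polygon has only
    positive slopes. *)
Lemma prod_dominated (L : fieldType) (O : valring L) (c : L) (us : seq L) :
  {in us, forall u, wlt O u c} ->
  let q := \prod_(u <- us) (u%:P + c *: 'X) in
  q`_0 != 0 /\ forall j, (0 < j)%N -> wlt O q`_0 q`_j.
Proof.
elim: us => [|u us IHus] lt /=.
  rewrite big_nil coef1 oner_neq0; split=> // j j0.
  by rewrite coef1 (gtn_eqF j0) wltx0 oner_neq0.
have [|q0 qj] := IHus; first by move=> w usw; apply: lt; rewrite inE usw orbT.
set q := \prod_(w <- us) _ in q0 qj *.
have uc := lt u (mem_head _ _); have u0 := wlt_neq0 uc.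
rewrite big_cons -/q.
have E j : ((u%:P + c *: 'X) * q)`_j = u * q`_j + c * (if j == 0 then 0 else q`_j.-1).
  by rewrite mulrDl coefD mul_polyC coefZ -scalerAl coefZ coefXM.
rewrite !E eqxx mulr0 addr0; split; first by rewrite mulf_neq0.
move=> j j0; rewrite E (gtn_eqF j0); apply: wltD.
  by rewrite /wlt wle_pM2l //; apply: qj.
apply: wltM => //; case: j j0 => //= j _.
by case: j => [|j]; [apply: wlexx | apply/wltW/qj].
Qed.

Section ApproximationData.
Variables (p : nat) (F : fieldType) (G : orderedZmodType).
Variables (charFp : p \in [pchar F]) (v : valuation F G).
Local Notation R := (skewpoly (pFrobenius_aut charFp)).
Local Notation O := (valring_of v).

(** The value of c a stands for v(x - a), where x is an ideal point without best
    approximation in F. *)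
Record approx_data (c : F -> F) : Prop := ApproxData {
  approx_neq0 : forall a, c a != 0;
  approx_ultra : forall a a', wle O (c a) (c a') -> wle O (c a) (a - a');
  approx_exact : forall a a', wlt O (c a) (c a') -> wle O (a - a') (c a);
  approx_nomax : forall a, exists a', wlt O (c a) (c a')
}.

Variables (c : F -> F) (hc : approx_data c) (r : R) (b : F).
Hypothesis hensv : henselian v.
Hypothesis r0 : skcoef r 0 != 0.
Hypothesis hr : forall a, exists2 i, skcoef r i != 0 &
  wle O (skcoef r i * c a ^+ (p ^ i)) ((addpoly r).[a] - b).

(** The roots of [addpoly r] - b at distance c a from every a form a coset T of an
    additive group, stable under the Galois group: the product of the X - t, t in
    T, has coefficients in F, is additive up to a constant, and its value at a is
    |T| times the one of c a. *)
Lemma approx_data_no_max : exists (Q : {poly F}) (b' : F), additive_polynomial Q /\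
  forall a, exists a', wlt O (Q.[a] - b') (Q.[a'] - b').
Proof.
pose P := addpoly r - b%:P.
have P' : P^`() = (skcoef r 0)%:P by rewrite derivB deriv_addpoly derivC subr0.
have P0 : P != 0.
  by apply: contraNneq r0 => P0; rewrite -polyC_eq0 -P' P0 deriv0.
have sepP : separable_poly P.
  rewrite unlock; apply/Bezout_eq1_coprimepP; exists (0, (skcoef r 0)^-1%:P).
  by rewrite /= mul0r add0r P' -polyCM mulVf.
have [L [rs [DP genL]]] := splitting_field P0.
set e := in_alg L : {rmorphism F -> L}; pose eP := map_poly e P.
have {}DP : eP %= \prod_(t <- rs) ('X - t%:P) by [].
have [O' ext] := valring_extension e O.
have wext : forall x y, wle O' (e x) (e y) = wle O x y := wle_map ext.
have galL : galois 1 {:L}.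
  apply/splitting_galoisField; exists eP; split.
  - by apply/polyOver1P; exists P.
  - by rewrite separable_map.
  by exists rs.
have Urs : uniq rs by rewrite -separable_prod_XsubC -(eqp_separable DP) separable_map.
have galO (s : gal_of {:L}) x y : wle O' (s x) (s y) = wle O' x y.
  have sO := henselian_gal_valring ext hensv galL s.
  by rewrite /wle !fmorph_eq0 -fmorph_div /= sO.
have rsP t : (t \in rs) = (eP.[t] == 0).
  by rewrite -root_prod_XsubC -(eqp_root DP) rootE.
have evP t : eP.[t] = (map_poly e (addpoly r)).[t] - e b.
  by rewrite /eP rmorphB /= map_polyC hornerD hornerN hornerC.
(* Otherwise the roots of P(a + c a X) are all outside the unit ball, and its
   constant term P(a) would have a smaller value than its other
   coefficients, against hr. *)
have near a : exists2 t, t \in rs & wle O' (e (c a)) (t - e a).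
  apply: contrapT => none.
  have far t : t \in rs -> wlt O' (e a - t) (e (c a)).
    by rewrite /wlt wleBC => rst; apply/negP => le; apply: none; exists t.
  have [k k0 Ek] := eqp_scale DP.
  have [|q0 qdom] := @prod_dominated _ O' (e (c a)) [seq e a - t | t <- rs].
    by move=> _ /mapP[t rst ->]; apply: far.
  set q := \prod_(u <- _) _ in q0 qdom.
  have Eq : map_poly e (P \Po (a%:P + c a *: 'X)) = k *: q.
    have Ex : map_poly e (a%:P + c a *: 'X) = (e a)%:P + e (c a) *: 'X.
      by rewrite rmorphD /= map_polyC map_polyZ map_polyX.
    rewrite map_comp_poly -/eP Ek Ex comp_polyZ rmorph_prod /q big_map.
    congr (_ *: _); apply: eq_bigr => t _.
    by rewrite /= comp_polyB comp_polyX comp_polyC polyCB addrAC.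
  have coefq j : e (P \Po (a%:P + c a *: 'X))`_j = k * q`_j.
    by rewrite -coef_map Eq coefZ.
  have [i ri0] := hr a; apply/negP.
  have pi0 : (0 < p ^ i)%N by rewrite expn_gt0 prime_gt0 // (pcharf_prime charFp).
  have Di : (P \Po (a%:P + c a *: 'X))`_(p ^ i) = skcoef r i * c a ^+ (p ^ i).
    by rewrite comp_polyB coefB coef_addpoly_comp comp_polyC coefC (gtn_eqF pi0) subr0.
  have D0 : (P \Po (a%:P + c a *: 'X))`_0 = (addpoly r).[a] - b.
    by rewrite -horner_coef0 horner_comp !hornerE ?mulr0 ?addr0.
  rewrite -Di -D0 -wext !coefq wle_pM2l //; exact: qdom.
(* Take a nearest to the ideal point among points at which the single roots
   fail: a root near a then cannot fail at its own point. *)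
have [x rsx limx] : exists2 t, t \in rs & forall a, wle O' (e (c a)) (t - e a).
  apply: contrapT => none.
  have fails t : exists a, t \in rs -> ~~ wle O' (e (c a)) (t - e a).
    have [rst|nrst] := boolP (t \in rs); last by exists 0.
    apply: contrapT => nofail; apply: none; exists t => // a.
    by apply: contrapT => /negP nle; apply: nofail; exists a.
  have [f fP] := choice fails.
  have [a sa amax] := wle_argmax O c 0 (map f rs).
  have [t rst ta] := near a; case/negP: (fP t rst).
  have cle : wle O (c (f t)) (c a) by apply: amax; rewrite inE map_f ?orbT.
  apply: (wle_tri (e a)); first by apply: wle_trans ta; rewrite wext.
  by rewrite -rmorphB wext wleBC; apply: (approx_ultra hc).
pose T := [seq t <- rs | `[< forall a, wle O' (e (c a)) (t - e a) >]].
have TP t : reflect (t \in rs /\ forall a, wle O' (e (c a)) (t - e a)) (t \in T).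
  rewrite mem_filter; apply: (iffP andP) => [[/asboolP]|[]] //.
  by move=> rst lt; split=> //; apply/asboolP.
have UT : uniq T by rewrite filter_uniq.
have Tx : x \in T by apply/TP.
have Tgal (s : gal_of {:L}) : {in T, forall t, s t \in T}.
  move=> t /TP[rst limt]; apply/TP; split=> [|a].
    have eP_s : map_poly s eP = eP.
      by rewrite -map_poly_comp; apply: eq_map_poly => a; apply: gal_in_alg.
    by move: rst; rewrite !rsP -{2}eP_s horner_map fmorph_eq0.
  have := galO s (e (c a)) (t - e a); rewrite rmorphB /= !gal_in_alg => ->.
  exact: limt.
have [g Dg] : exists g, \prod_(t <- T) ('X - t%:P) = map_poly e g.
  apply/polyOver1P/polyOverP => i.
  rewrite -(galois_fixedField galL).
  apply/fixedFieldP; first exact: memvf.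
  move=> s _; rewrite -coef_map; congr ((_ : {poly L})`_i); rewrite rmorph_prod.
  rewrite -[RHS](perm_big _ (perm_map_stable (fmorph_inj s) UT (Tgal s))) big_map.
  by apply: eq_bigr => t _; rewrite rmorphB /= map_polyX map_polyC.
have upper t a : t \in T -> wle O' (t - e a) (e (c a)).
  case/TP=> _ limt; have [a' lt] := approx_nomax hc a.
  have le : wle O' (e a' - e a) (e (c a)).
    by rewrite -rmorphB wext wBCle; apply: (approx_exact hc).
  apply: (wle_trans _ _ le); rewrite -[t - e a](subrKA (e a')) addrC.
  apply: wle_addl; apply: (wle_lt_trans _ le).
  by apply: (wlt_le_trans _ _ (limt a')); rewrite /wlt wext.
pose K := [seq t - x | t <- T].
have addK : additive_polynomial (\prod_(k <- K) ('X - k%:P)).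
  apply: additive_prod_XsubC.
  - by rewrite map_inj_uniq //; apply: addIr.
  - by rewrite -size_eq0 size_map size_eq0; apply: contraTneq Tx => ->.
  move=> _ _ /mapP[t /TP[rst limt] ->] /mapP[u /TP[rsu limu] ->].
  rewrite opprB subrKA; apply/mapP; exists (t - u + x); rewrite ?addrK //.
  apply/TP; split=> [|a].
    move: rst rsu rsx; rewrite !rsP !evP !addpoly_mapD addpoly_mapN.
    by rewrite !subr_eq0 => /eqP-> /eqP-> /eqP->; rewrite subrr add0r.
  have -> : t - u + x - e a = (t - e a) + (e a - u) + (x - e a) by ring.
  by apply: wleD; [apply: wleD; rewrite // wleBC | ].
have addA := additive_comp ((- x)%:P) addK; set A := \prod_(k <- K) _ in addK addA.
pose Q := g - (g`_0)%:P.
have DA : A = map_poly e Q.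
  have E : map_poly e g = A \Po ((- x)%:P + 'X).
    rewrite -Dg rmorph_prod big_map; apply: eq_bigr => t _.
    by rewrite /= comp_polyB comp_polyX comp_polyC polyCB polyCN; ring.
  have A0 : A`_0 = 0.
    rewrite -horner_coef0; apply/rootP; rewrite root_prod_XsubC.
    by apply/mapP; exists x; rewrite ?subrr.
  have eg0 : e g`_0 = A.[- x].
    by rewrite -coef_map E addA comp_polyCr coefD coefC A0 eqxx addr0.
  rewrite rmorphB /= map_polyC -[_ g`_0]/(e g`_0) eg0 E addA comp_polyCr.
  by rewrite addrAC subrr add0r.
exists Q, (- g`_0); split.
  by apply: (additive_polynomial_map (iota := e)); rewrite -DA.
have Qg a : Q.[a] - - g`_0 = g.[a] by rewrite hornerD hornerN hornerC opprK subrK.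
move=> a; have [a' lt] := approx_nomax hc a; exists a'; rewrite !Qg.
have eg d : e g.[d] = \prod_(t <- T) (e d - t).
  rewrite -horner_map /= -Dg horner_prod; apply: eq_bigr => t _.
  by rewrite hornerXsubC.
rewrite /wlt -wext !eg -/(wlt _ _ _).
have ltT t : t \in T -> wlt O' (e a - t) (e a' - t).
  move=> Tt; rewrite /wlt wleBC wBCle -/(wlt _ _ _).
  apply: (wle_lt_trans _ (upper t a Tt)).
  have [_ limt] := TP t Tt; apply: (wlt_le_trans _ _ (limt a')).
  by rewrite /wlt wext.
rewrite (perm_big _ (perm_to_rem Tx)) [in X in wlt _ _ X](perm_big _ (perm_to_rem Tx)).
rewrite !big_cons; apply: wltM; last 1 first.
- by apply: wle_prod => t /mem_rem/ltT/wltW.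
- rewrite prodf_seq_neq0; apply/allP => t /mem_rem/ltT; exact: wlt_neq0.
exact: ltT.
Qed.
End ApproximationData.

(** * Affine immediate extensions of the module F *)

Lemma valuationX (F : fieldType) (G : orderedZmodType) (v : valuation F G) x n :
  v (x ^+ n) = v x *+ n.
Proof.
elim: n => [|n IHn]; first by rewrite expr0 valuation1.
by rewrite exprS valuationM IHn mulrS.
Qed.

Lemma ractM (K : fieldType) (phi : {rmorphism K -> K})
    (M : lmodType (skewpoly phi)^c) (x : M) (r s : skewpoly phi) :
  ract x (r * s) = ract (ract x r) s.
Proof. by rewrite /ract scalerA. Qed.

Lemma ract_sum (K : fieldType) (phi : {rmorphism K -> K})
    (M : lmodType (skewpoly phi)^c) (x : M) n (r : 'I_n -> skewpoly phi) :
  ract x (\sum_i r i) = \sum_i ract x (r i).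
Proof. by rewrite /ract scaler_suml. Qed.

Lemma ractB (K : fieldType) (phi : {rmorphism K -> K})
    (M : lmodType (skewpoly phi)^c) (x y : M) (r : skewpoly phi) :
  ract (x - y) r = ract x r - ract y r.
Proof. by rewrite /ract scalerBr. Qed.

Lemma skew_factor_t (K : fieldType) (phi : {rmorphism K -> K}) (r : skewpoly phi) :
  skcoef r 0 = 0 -> r != 0 ->
  exists s : skewpoly phi, [/\ s != 0, (sksize s < sksize r)%N & r = skT phi * s].
Proof.
move=> r0 rn0; pose n := (sksize r).-1.
pose s : skewpoly phi := \sum_(i < n) skmono phi i (skcoef r i.+1).
have szr : (0 < sksize r)%N by rewrite /sksize size_poly_gt0.
have Dr : r = skT phi * s.
  rewrite {1}(skmono_sum r) -(prednK szr) big_ord_recl r0 /skmono scale0r add0r.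
  rewrite mulr_sumr; apply: eq_bigr => i _.
  by rewrite -/(skmono phi _ _) /skT skmonoM iter_phi1 mul1r add1n.
exists s; split=> //; first by apply: contraNneq rn0 => s0; rewrite Dr s0 mulr0.
rewrite -(prednK szr) ltnS -/n.
have -> : s = (\poly_(i < n) skcoef r i.+1 : {poly K}) by rewrite poly_def.
exact: size_poly.
Qed.

Section ModuleExtension.
Variables (p : nat) (F : fieldType) (G : orderedZmodType).
Variables (charFp : p \in [pchar F]) (v : valuation F G).
Local Notation phi := (pFrobenius_aut charFp : {rmorphism F -> F}).
Local Notation R := (skewpoly phi).
Local Notation O := (valring_of v).
Variables (N : valued_module phi) (f : vmod_extension (field_valued_module charFp v) N).
Local Notation h := (vmod_chain_emb f).
Local Notation w := (@vmod_val _ _ N).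
Implicit Types (x y z : N) (a b c : F) (r : R).

Lemma vext_emb a : w (f a) = h (v a).
Proof. exact: (vmod_emb_val f). Qed.

Lemma vext_le (g g' : extended G) : (h g <= h g')%O = (g <= g').
Proof. exact: (vmod_chain_emb_mono f). Qed.

Lemma vext_lt (g g' : extended G) : (h g < h g')%O = (g < g').
Proof. by rewrite !ltNge vext_le. Qed.

Lemma vext_ract a r : f ((addpoly r).[a]) = ract (f a) r.
Proof.
rewrite -[LHS]/(f ((r : R^c) *: (a : field_valued_module charFp v))).
by rewrite linearZ.
Qed.

Lemma vmod_leB x y (m : vmod_chain N) :
  (m <= w x)%O -> (m <= w y)%O -> (m <= w (x - y)%R)%O.
Proof.
move=> mx my; apply: le_trans (vmod_valB (vmod_axioms N) x y).
by rewrite le_min mx my.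
Qed.

Lemma vmod_ltB x y (m : vmod_chain N) :
  (m < w x)%O -> (m < w y)%O -> (m < w (x - y)%R)%O.
Proof.
move=> mx my; apply: lt_le_trans (vmod_valB (vmod_axioms N) x y).
by rewrite lt_min mx my.
Qed.

Lemma vmod_near x y : (w y < w (x - y)%R)%O -> w x = w y.
Proof.
move=> lt; apply/le_anti/andP; split.
  rewrite leNgt; apply/negP => lt'.
  by have := vmod_ltB lt' lt; rewrite opprB addrC subrK ltxx.
have -> : w x = w ((x - y) - (- y)) by rewrite opprK subrK.
apply: vmod_leB; first exact: ltW.
have := vmod_leB (x := 0) (y := y) (m := w y); rewrite sub0r; apply=> //.
by have /(vmod_val_top (vmod_axioms N)) -> : (0 : N) = 0 by []; apply: lex1.
Qed.

Lemma vmod_value (imm : immediate_vmod f) x : x != 0 -> exists2 c, c != 0 & w x = h (v c).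
Proof.
move=> x0; have [c lt] := imm x x0; have E := vmod_near lt.
exists c; last by rewrite E vext_emb.
apply: contraNneq x0 => c0; apply/eqP/(vmod_val_top (vmod_axioms N)).
by rewrite E c0; apply/(vmod_val_top (vmod_axioms N)); apply: linear0.
Qed.

Lemma vmod_ract_mono z g n a : a != 0 -> w z = h g ->
  w (ract z (skmono phi n a)) = h (g *+ (p ^ n) + v a).
Proof.
move=> a0 zg; rewrite skmonoE ractM (vmod_val_scal (vmod_axioms N)).
have -> : w (ract z (skT phi ^+ n)) = h (g *+ (p ^ n)).
  elim: n => [|n IHn]; first by rewrite expr0 /ract scale1r.
  rewrite exprSr ractM (vmod_val_t (vmod_axioms N)) IHn -(vmod_chain_emb_act f).
  by rewrite [chain_act _ _]value_act_t -mulrnA expnSr.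
by rewrite -(vmod_chain_emb_act f) [chain_act _ _]value_act_scal.
Qed.

Lemma vmod_ract_ge z g r : r != 0 -> w z = h g ->
  exists2 i, skcoef r i != 0 & (h (g *+ (p ^ i) + v (skcoef r i)) <= w (ract z r))%O.
Proof.
move=> r0 zg; have szr : (0 < sksize r)%N by rewrite /sksize size_poly_gt0.
have ltn : ((sksize r).-1 < sksize r)%N by rewrite prednK.
have lead0 : skcoef r (Ordinal ltn) != 0.
  by rewrite /skcoef /= -/(lead_coef (r : {poly F})) lead_coef_eq0.
pose val (i : 'I_(sksize r)) := h (g *+ (p ^ i) + v (skcoef r i)).
have [i ri0 imin] := @arg_minP _ _ _ (Ordinal ltn)
  (fun i : 'I_(sksize r) => skcoef r i != 0) val lead0.
exists i => //; rewrite -/(val i).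
have -> : ract z r = \sum_(j < sksize r) ract z (skmono phi j (skcoef r j)).
  by rewrite {1}(skmono_sum r) ract_sum.
apply: (big_ind (fun y => (val i <= w y)%O)) => [|x y lx ly|j _].
- by have /(vmod_val_top (vmod_axioms N)) -> : (0 : N) = 0 by []; apply: lex1.
- apply: le_trans (vmod_valD (vmod_axioms N) x y).
  by rewrite le_min lx ly.
have [->|rj0] := eqVneq (skcoef r j) 0; last by rewrite (vmod_ract_mono _ rj0 zg) imin.
rewrite /skmono scale0r /ract scale0r.
by have /(vmod_val_top (vmod_axioms N)) -> : (0 : N) = 0 by []; apply: lex1.
Qed.

Hypotheses (imm : immediate_vmod f) (hensv : henselian v).
Hypothesis maxQ : forall (Q : {poly F}) b, additive_polynomial Q ->
  exists a0, forall a, v (Q.[a] - b) <= v (Q.[a0] - b).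

(** If x is not in F, then any a is improved by some a' nearer to x, and
    (x - a).t = d - a^p improves with x - a. *)
Lemma immediate_root_t x d : f d = ract x (skT phi) -> exists a, f a = x.
Proof.
move=> fd; apply: contrapT => nx.
have addX : additive_polynomial ('X^p : {poly F}).
  apply/(additive_polynomialP charFp); exists (skT phi).
  by rewrite addpoly_mono scale1r expn1.
have [a0 max0] := maxQ d addX.
have x0 a : x - f a != 0.
  by apply/negP => /eqP/subr0_eq xa; apply: nx; exists a.
have Et a : ract (x - f a) (skT phi) = f (d - a ^+ p).
  rewrite ractB -fd -vext_ract addpoly_mono scale1r expn1 hornerXn.
  by rewrite [RHS](raddfB f).
have [c lt] := imm (x0 a0).
have wtop a : w (x - f a) != \top%O.
  by apply/negP => /eqP /(vmod_val_top (vmod_axioms N))/eqP; rewrite (negPf (x0 a)).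
have nearer : (w (x - f a0) < w (x - f (a0 + c)))%O.
  by rewrite (vmod_near lt) [f (_ + _)](raddfD f) opprD addrA.
have := chain_lt_t (chain_axioms (vmod_chain N)) (wtop (a0 + c)) (wtop a0) nearer.
rewrite -!(vmod_val_t (vmod_axioms N)) !Et !vext_emb vext_lt.
rewrite -![v (d - _)]valuationN !opprB ltNge.
by have := max0 (a0 + c); rewrite !hornerXn => ->.
Qed.

(** The distances v(x - a) have no maximum, and v(y - Q(a)), for Q the polynomial
    of r, is the value of (x - a).r; as such it is at least the least value of a
    monomial of r at v(x - a). *)
Lemma immediate_root_separable x (y : F) r : skcoef r 0 != 0 -> f y = ract x r ->
  exists a, f a = x.
Proof.
move=> r0 fy; apply: contrapT => nx.
have x0 a : x - f a != 0.
  by apply/negP => /eqP/subr0_eq xa; apply: nx; exists a.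
have /choice[c cP] a : exists c, c != 0 /\ w (x - f a) = h (v c).
  by have [c c0 E] := vmod_value imm (x0 a); exists c.
have fB a a' : f (a - a' : F) = (x - f a') - (x - f a).
  by rewrite [LHS](raddfB f) opprB [RHS]addrC subrKA.
have hc : approx_data v c.
  split=> [a|a a'|a a'|a].
  - by have [] := cP a.
  - rewrite !wle_valring_of -!vext_le -(vext_emb (a - a')) fB => le.
    have [[_ ca] [_ ca']] := (cP a, cP a').
    by apply: vmod_leB; rewrite ?ca ?ca'.
  - rewrite wle_valring_of wlt_valring_of -vext_lt -vext_le -(vext_emb (a - a')) => lt.
    have [[_ ca] [_ ca']] := (cP a, cP a').
    rewrite leNgt; apply/negP => lt'; rewrite -ca' in lt.
    have := vmod_ltB lt lt'.
    by rewrite fB opprB addrC subrK ca ltxx.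
  have [d lt] := imm (x0 a); exists (a + d).
  have [[_ ca] [_ ca']] := (cP a, cP (a + d)).
  rewrite wlt_valring_of -vext_lt -ca -ca' (vmod_near lt).
  by rewrite [f (_ + _)](raddfD f) opprD addrA.
have hr a : exists2 i, skcoef r i != 0 &
    wle O (skcoef r i * c a ^+ (p ^ i)) ((addpoly r).[a] - y).
  have rn0 : r != 0 by apply: contraNneq r0 => ->; rewrite /skcoef coef0.
  have [_ ca] := cP a; have [i ri0 le] := vmod_ract_ge rn0 ca; exists i => //.
  rewrite wle_valring_of valuationM valuationX addrC.
  have E : f (y - (addpoly r).[a]) = ract (x - f a) r.
    transitivity (f y - f (addpoly r).[a]); first exact: raddfB.
    by rewrite vext_ract fy ractB.
  by rewrite -vext_le -(valuationN v (_ - y)) opprB -(vext_emb (y - _)) E.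
have [Q [b [addQ nomax]]] := approx_data_no_max hc hensv r0 hr.
have [a0 max0] := maxQ b addQ; have [a] := nomax a0.
by rewrite wlt_valring_of ltNge max0.
Qed.

Lemma immediate_root r x (y : F) : r != 0 -> f y = ract x r -> exists a, f a = x.
Proof.
have [n] := ubnP (sksize r); elim: n => // n IHn in r x y * => szr rn0 fy.
have [r0|r0] := eqVneq (skcoef r 0) 0; last exact: immediate_root_separable r0 fy.
have [s [sn0 szs Dr]] := skew_factor_t r0 rn0.
have [d fd] : exists d, f d = ract x (skT phi).
  apply: (IHn s _ y) => //; first exact: leq_trans szs _.
  by rewrite -ractM -Dr.
exact: immediate_root_t fd.
Qed.

End ModuleExtension.

(** * Immediate algebraic field extensions as affine module extensions *)

Lemma addpoly_mapM (p : nat) (F L : fieldType) (charFp : p \in [pchar F])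
    (iota : {rmorphism F -> L}) (r s : skewpoly (pFrobenius_aut charFp)) x :
  (map_poly iota (addpoly (r * s))).[x] =
  (map_poly iota (addpoly s)).[(map_poly iota (addpoly r)).[x]].
Proof.
have e0 u : (map_poly iota (addpoly u)).[0] = 0.
  by apply: (addrI (map_poly iota (addpoly u)).[0]); rewrite -addpoly_mapD !addr0.
elim/skew_ind: r s => [s|r1 r2 IH1 IH2 s|i a].
- by rewrite mul0r addpoly0 rmorph0 horner0 e0.
- by rewrite mulrDl !addpolyD !rmorphD /= !hornerD !addpoly_mapD IH1 IH2.
elim/skew_ind=> [|s1 s2 IH1 IH2|j b].
- by rewrite mulr0 addpoly0 rmorph0 !horner0.
- by rewrite mulrDr !addpolyD !rmorphD /= !hornerD IH1 IH2.
rewrite skmonoM !addpoly_mono !map_polyZ /= !map_polyXn !hornerZ !hornerXn.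
rewrite iter_pFrobenius rmorphM rmorphXn /= exprMn -exprM -expnD.
by rewrite mulrCA mulrA.
Qed.

(** The size P + 1 residues of the X^(p^i) modulo P lie in a space of dimension
    size P, so they are linearly dependent. *)
Lemma additive_multiple (p : nat) (F : fieldType) (charFp : p \in [pchar F])
    (P : {poly F}) : P != 0 ->
  exists2 r : skewpoly (pFrobenius_aut charFp), r != 0 & P %| addpoly r.
Proof.
move=> P0; pose d := size P.
pose A : 'M[F]_(d.+1, d) := \matrix_(i < d.+1) poly_rV ('X^(p ^ i) %% P).
have kerA : kermx A != 0.
  rewrite -mxrank_eq0 mxrank_ker -lt0n subn_gt0.
  by apply: leq_ltn_trans (rank_leq_col A) _.
have [u /sub_kermxP uA u0] := rowV0Pn kerA.
pose r : skewpoly (pFrobenius_aut charFp) := rVpoly u : {poly F}.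
exists r.
  apply: contraNneq u0 => r0; rewrite -[u]rVpolyK.
  by rewrite [rVpoly u](r0 : rVpoly u = 0) linear0.
have szr : (sksize r <= d.+1)%N by apply: size_poly.
have -> : addpoly r = \sum_(i < d.+1) u 0 i *: 'X^(p ^ i).
  by rewrite (addpoly_widen szr); apply: eq_bigr => i _; rewrite /skcoef coef_rVpoly_ord.
have rem0 : \sum_(i < d.+1) u 0 i *: ('X^(p ^ i) %% P) = 0.
  have := congr1 rVpoly uA; rewrite linear0 mulmx_sum_row linear_sum => {2}<-.
  apply: eq_bigr => i _.
  by rewrite linearZ /= rowK poly_rV_K // /d ltnW // ltn_modp.
under eq_bigr do rewrite (divp_eq 'X^(p ^ _) P) scalerDr scalerAl.
by rewrite big_split /= rem0 addr0 -mulr_suml dvdp_mull.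
Qed.

Definition extension_module (p : nat) (F L : fieldType)
    (charFp : p \in [pchar F]) (iota : {rmorphism F -> L}) : Type := L.

Section ExtensionModule.
Variables (p : nat) (F L : fieldType) (charFp : p \in [pchar F]).
Variable iota : {rmorphism F -> L}.
Local Notation phi := (pFrobenius_aut charFp : {rmorphism F -> F}).
Local Notation R := (skewpoly phi).
Local Notation N := (extension_module charFp iota).

HB.instance Definition _ := GRing.Zmodule.on N.

Definition extension_scale (r : R^c) (x : N) : N :=
  (map_poly iota (addpoly (r : R))).[x : L].

Fact extension_scaleA (r s : R^c) (x : N) :
  extension_scale r (extension_scale s x) = extension_scale (r * s) x.
Proof. by rewrite /extension_scale -addpoly_mapM. Qed.

Fact extension_scale1 : left_id 1 extension_scale.
Proof.
move=> x; rewrite /extension_scale addpoly_mono scale1r map_polyXn.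
by rewrite hornerXn expr1.
Qed.

Fact extension_scaleDr : right_distributive extension_scale +%R.
Proof. by move=> r x y; rewrite /extension_scale addpoly_mapD. Qed.

Fact extension_scaleDl (x : N) : {morph extension_scale^~ x : r s / r + s}.
Proof. by move=> r s; rewrite /extension_scale addpolyD rmorphD hornerD. Qed.

HB.instance Definition _ := GRing.Zmodule_isLmodule.Build R^c N
  extension_scaleA extension_scale1 extension_scaleDr extension_scaleDl.

Definition extension_emb (x : frobenius_module charFp) : N := iota x.

Fact extension_emb_linear : linear extension_emb.
Proof.
move=> r x y; rewrite /extension_emb [iota _]rmorphD; congr (_ + _).
exact/esym/horner_map.
Qed.

HB.instance Definition _ :=
  GRing.isLinear.Build R^c (frobenius_module charFp) N *:%R extension_emb
    extension_emb_linear.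

Variables (G : orderedZmodType) (v : valuation F G) (w : valuation L G).
Hypothesis we : forall x, w (iota x) = v x.

(** As w has the value group of v, the chain of F serves for the extension. *)
Definition extension_val (x : N) : value_chain charFp v := w (x : L).

Fact extension_val_axioms : is_valued_module extension_val.
Proof.
split.
- exact: valuation_surj.
- exact: valuationD.
- by move=> x y; rewrite -[extension_val y](valuationN w); apply: valuationD.
- exact: valuation_eq_top.
- move=> x a; rewrite [RHS]value_act_scal -we -valuationM; congr (w _).
  rewrite /Defs.ract /GRing.scale /= /extension_scale addpoly_mono map_polyZ /=.
  by rewrite map_polyXn hornerZ hornerXn mulrC.
move=> x; rewrite [RHS]value_act_t -valuationX; congr (w _).
rewrite /Defs.ract /GRing.scale /= /extension_scale addpoly_mono scale1r.
by rewrite map_polyXn hornerXn expn1.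
Qed.

Definition extension_valued_module : valued_module phi :=
  ValuedModule extension_val_axioms.

Definition extension_vmod : vmod_extension (field_valued_module charFp v)
  extension_valued_module := @VmodExtension _ _ (field_valued_module charFp v)
  extension_valued_module extension_emb id (fmorph_inj iota) (fun _ _ => erefl)
  erefl (fun _ _ => erefl) we.

End ExtensionModule.

Section AffinelyMaximal.
Variables (p : nat) (F : fieldType) (G : orderedZmodType).
Variables (charFp : p \in [pchar F]) (v : valuation F G).

Lemma immediate_vfield_approx (L : fieldType) (H : orderedZmodType)
    (w : valuation L H) (e : vfield_extension v w) : immediate_vfield e ->
  forall y, y != 0 -> exists a, wlt (valring_of w) y (y - e a).
Proof.
move=> [sameG sameK] y y0; have [g Ey] := valuation_Some w y0.
have [g' Dg] := sameG g; have [c vc] := valuation_surj v (Some g' : extended G).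
have wc : w (e c) = w y by rewrite Ey (vfield_emb_val e) vc /= Dg.
have c0 : e c != 0.
  apply: contraNneq y0 => c0; apply/eqP/(valuation_eq_top w).
  by rewrite -wc c0 valuation0.
have [|a _] := sameK (y / e c).
  rewrite -[in_valuation_ring w _]/(valring_of w _) -wle1 -(wle_pM2r _ _ _ c0).
  by rewrite mul1r divfK // wle_valring_of wc.
rewrite /in_valuation_ideal -(valuation1 w) -wlt_valring_of => lt.
exists (c * a); have -> : y - e (c * a) = (y / e c - e a) * e c.
  by rewrite mulrBl divfK // rmorphM mulrC.
rewrite -[X in wlt _ X _]mul1r; apply: wltM => //.
by rewrite wle_valring_of wc.
Qed.

Lemma affinely_maximal_algebraically_maximal :
  affinely_maximal (field_valued_module charFp v) -> algebraically_maximal v.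
Proof.
move=> maxM L H w0 e alg imm0 y; have imm := immediate_vfield_approx imm0.
have ext x : valring_of w0 (e x) = in_valuation_ring v x.
  rewrite /= /in_valuation_ring (vfield_emb_val e); case: (v x) => [g|] //=.
  by rewrite -[LHS]/(0 <= vgroup_emb e g) -(raddf0 (vgroup_emb e)) (vgroup_emb_mono e).
have [w wle_w we] := immediate_valuation ext imm.
apply: (maxM (extension_valued_module charFp we) (extension_vmod charFp we)).
  move=> x; have [P P0 Px] := alg x.
  have [r r0 /dvdpP[q Dr]] := additive_multiple charFp P0.
  exists r => //; exists 0; transitivity (0 : L); first exact: (rmorph0 e).
  rewrite /Defs.ract /GRing.scale /= /extension_scale Dr rmorphM hornerM.
  by rewrite (rootP Px) mulr0.
move=> x x0; have [a lt] := imm x x0; exists a.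
have [_ le] := wle_sub_lt lt.
have := wle_lt_trans _ le lt; rewrite /wlt !wle_w -ltNge; exact.
Qed.

End AffinelyMaximal.

Theorem corollary3p26 (p : nat) (F : fieldType) (G : orderedZmodType)
    (charFp : p \in [pchar F]) (v : valuation F G) :
  henselian v -> nontrivial v ->
  [<-> affinely_maximal (field_valued_module charFp v);
       algebraically_maximal v;
       forall P : {poly F}, has_max (fun g => exists a : F, v P.[a] = g);
       forall (Q : {poly F}) (b : F), additive_polynomial Q ->
         has_max (fun g => exists a : F, v (Q.[a] - b) = g)].
Proof.
move=> hensv _; tfae.
- exact: affinely_maximal_algebraically_maximal.
- move=> maxv P; have [a0 max0] := algebraically_maximal_attains_max maxv P.
  exists (v P.[a0]); first by exists a0.
  by move=> _ [a <-]; rewrite -wle_valring_of.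
- move=> maxP Q b _; have [m [a0 <-] max0] := maxP (Q - b%:P).
  exists (v (Q.[a0] - b)); first by exists a0.
  by move=> _ [a <-]; have := max0 _ (ex_intro _ a erefl); rewrite !hornerE.
move=> maxQ N f aff imm x; have [r r0 [y fy]] := aff x.
apply: (immediate_root imm hensv _ r0 fy) => Q b addQ.
have [m [a0 <-] max0] := maxQ Q b addQ; exists a0 => a.
by apply: max0; exists a.
Qed.
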